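(* There are exactly eight forcibly polyhedral sequences (degree sequences being considered up to the order of their terms), namely the five sequences \[s_a:\ (a+3)^{4-a},\,(a+2)^a,\,3^a, \qquad 0\leq a\leq 4,\] together with the degree sequence $4^6$ of the octahedron, the degree sequence $4,3^4$ of the square pyramid, and the degree sequence $5,3^5$ of the pentagonal pyramid.
   Context: All graphs are finite, with no multiple edges or loops. The degree sequence of a graph with $p$ vertices is the list $d_1,\dots,d_p$ of the degrees of its vertices (the order of the terms is immaterial). In a sequence, the expression $d^k$ means $k$ copies of the integer $d$ (no copies if $k=0$). A sequence $s$ of $p$ non-negative integers is graphical if there exists a graph with degree sequence $s$; any such graph is called a realisation of $s$. A graph is called a polyhedron (or polyhedral) if it is the $1$-skeleton of a (convex) polyhedral solid; equivalently, it is planar and $3$-connected (in particular, it has at least $4$ vertices). A graphical sequence $s$ is forcibly polyhedral if every realisation of $s$ is a polyhedron. The $n$-gonal pyramid is the graph obtained from a cycle on $n$ vertices by adding one new vertex adjacent to all vertices of the cycle; the square and pentagonal pyramids are the cases $n=4$ and $n=5$. *)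

(* Defs.v *)
(* World: MathComp / MathComp-Analysis. *)
From HB Require Import structures.
From mathcomp Require Import all_boot all_order all_algebra.
From mathcomp Require Import all_classical all_reals all_analysis.

Set Implicit Arguments.
Unset Strict Implicit.
Unset Printing Implicit Defensive.

Import Order.TTheory GRing.Theory Num.Theory.
Import numFieldNormedType.Exports.

Local Open Scope classical_set_scope.

Record sgraph := SGraph {
  vertex :> finType;
  edge : rel vertex;
  edge_sym : symmetric edge;
  edge_irr : irreflexive edge
}.

Definition degree (G : sgraph) (x : G) : nat := #|[pred y | edge x y]|.

Definition degree_sequence (G : sgraph) : seq nat :=
  [seq degree x | x <- enum G].

(* Sequences are lists, identified up to [perm_eq]. *)
Definition realisation (s : seq nat) (G : sgraph) : bool :=
  perm_eq (degree_sequence G) s.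

Definition graphical (s : seq nat) : Prop := exists G : sgraph, realisation s G.

Definition del_edge (G : sgraph) (X : {set G}) : rel G :=
  [rel x y | [&& x \notin X, y \notin X & edge x y]].

Definition kconnected (k : nat) (G : sgraph) : Prop :=
  (k < #|G|)%N /\
  forall X : {set G}, (#|X| < k)%N ->
    forall x y : G, x \notin X -> y \notin X -> connect (del_edge X) x y.

(* [gamma u v] parametrises, from [u] to [v], the arc that draws the edge uv;
   only its values on [0, 1], for adjacent u and v, matter. *)
Record plane_drawing (R : realType) (G : sgraph) (pos : G -> R * R)
    (gamma : G -> G -> R -> R * R) : Prop := PlaneDrawing {
  drawing_pos_inj : injective pos;
  drawing_cont : forall u v : G, edge u v ->
    {within `[0%R, 1%R], continuous (gamma u v)};
  drawing_inj : forall u v : G, edge u v ->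
    {in `[0%R, 1%R] &, injective (gamma u v)};
  drawing_ends : forall u v : G, edge u v ->
    gamma u v 0%R = pos u /\ gamma u v 1%R = pos v;
  drawing_rev : forall u v : G, edge u v ->
    {in `[0%R, 1%R], forall t : R, gamma v u t = gamma u v (1 - t)%R};
  drawing_vertex : forall u v w : G, edge u v ->
    {in `]0%R, 1%R[, forall t : R, gamma u v t <> pos w};
  drawing_cross : forall u v u' v' : G, edge u v -> edge u' v' ->
    [set u; v]%SET <> [set u'; v']%SET ->
    {in `]0%R, 1%R[ &, forall t t' : R, gamma u v t <> gamma u' v' t'}
}.

Definition planar (R : realType) (G : sgraph) : Prop :=
  exists (pos : G -> R * R) (gamma : G -> G -> R -> R * R),
    plane_drawing pos gamma.

(* By Steinitz's theorem, the 1-skeleta of convex polyhedral solids. *)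
Definition polyhedral (R : realType) (G : sgraph) : Prop :=
  planar R G /\ kconnected 3 G.

Definition forcibly_polyhedral (R : realType) (s : seq nat) : Prop :=
  graphical s /\ forall G : sgraph, realisation s G -> polyhedral R G.

Definition pyramid_rel (n : nat) : rel (option 'I_n) :=
  fun x y => match x, y with
  | Some i, Some j =>
      (i != j) && (((j : nat) == i.+1 %% n) || ((i : nat) == j.+1 %% n))
  | None, None => false
  | _, _ => true
  end.

Lemma pyramid_rel_sym (n : nat) : symmetric (@pyramid_rel n).
Proof. by case=> [i|] [j|] //=; rewrite eq_sym orbC. Qed.

Lemma pyramid_rel_irr (n : nat) : irreflexive (@pyramid_rel n).
Proof. by case=> [i|] //=; rewrite eqxx. Qed.

(* The n-gonal pyramid, for n >= 3; the apex is [None]. *)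
Definition pyramid (n : nat) : sgraph :=
  SGraph (@pyramid_rel_sym n) (@pyramid_rel_irr n).

(* (i, b) stands for the vertex +e_i or -e_i of the regular octahedron; distinct
   vertices are adjacent unless they are antipodal. *)
Definition octahedron_rel : rel ('I_3 * bool) := [rel x y | x.1 != y.1].

Lemma octahedron_rel_sym : symmetric octahedron_rel.
Proof. by move=> x y; rewrite /octahedron_rel /= eq_sym. Qed.

Lemma octahedron_rel_irr : irreflexive octahedron_rel.
Proof. by move=> x; rewrite /octahedron_rel /= eqxx. Qed.

Definition octahedron : sgraph := SGraph octahedron_rel_sym octahedron_rel_irr.

Definition s_ (a : nat) : seq nat :=
  nseq (4 - a) (a + 3) ++ nseq a (a + 2) ++ nseq a 3.

Definition forcibly_polyhedral_list : seq (seq nat) :=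
  [seq s_ a | a <- iota 0 5] ++
  [:: nseq 6 4; 4 :: nseq 4 3; 5 :: nseq 5 3].

(* Main.v *)
(* Necessity.  Sample a plane drawing so finely that the polygons of
   vertex-disjoint edges stay disjoint.  For two disjoint polygons, the parities
   of the numbers of segments of each that lie below the end points of the other
   satisfy a linear relation.  Summing these relations over the pairs of disjoint
   edges of K5 or K3,3 (or of a subdivision) gives 1 = 0, so that no Jordan curve
   theorem is needed to see that these graphs are not planar.

   Attaching new vertices preserves non-planarity, and by Havel-Hakimi switches
   every graphical sequence arises from a shorter one by attaching a vertex of
   minimal degree to vertices of the largest degrees.  By induction from a
   computation at ten terms, a graphical sequence of ten or more terms that are
   all at least 3 has a non-planar realisation, except for three families in
   which two adjacent vertices of degree 3 can be given the same two other
   neighbours, which then separate them from the rest.  Up to nine terms, the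
   same dichotomy is checked by computation and leaves only the eight sequences.

   Sufficiency.  Enumerating all labelled realisations of each of the eight
   sequences shows that it is realised by a single graph, for which a
   straight-line drawing and 3-connectivity are checked. *)

Require Import Defs.
From HB Require Import structures.
From mathcomp Require Import all_boot all_order all_algebra.
From mathcomp Require Import all_classical all_reals all_analysis.
From mathcomp Require Import ring lra zify.

Set Implicit Arguments.
Unset Strict Implicit.
Unset Printing Implicit Defensive.

Import Order.TTheory GRing.Theory Num.Theory.
Import numFieldNormedType.Exports.

(** * Parity of a pair of disjoint segments *)

Section Segments.
Local Open Scope ring_scope.
Variable F : realFieldType.
Implicit Types a b c d p : F * F.

Definition lexlt p q := (p.1 < q.1) || (p.1 == q.1) && (p.2 < q.2).

Definition area c d p := (d.1 - c.1) * (p.2 - c.2) - (d.2 - c.2) * (p.1 - c.1).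

(* Parity of the number of intersections of the segment cd with the downward
   vertical ray from p, tilted infinitesimally so that the lexicographic order
   replaces the comparison of abscissae. *)
Definition below p c d :=
  (lexlt c p (+) lexlt d p) &&
  (if lexlt c d then 0 < area c d p else area c d p < 0).

Definition disjoint_segments a b c d := forall l m : F,
  0 <= l <= 1 -> 0 <= m <= 1 ->
  (a.1 + l * (b.1 - a.1), a.2 + l * (b.2 - a.2)) <>
  (c.1 + m * (d.1 - c.1), c.2 + m * (d.2 - c.2)).

Lemma disjoint_segmentsC a b c d :
  disjoint_segments a b c d -> disjoint_segments c d a b.
Proof. by move=> H l m hl hm /esym; apply: H. Qed.

Lemma disjoint_segments_rev a b c d :
  disjoint_segments a b c d -> disjoint_segments b a c d.
Proof.
move=> H l m hl hm e; apply: (H (1 - l) m _ hm); first by lra.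
by rewrite -e; congr (_, _); ring.
Qed.

Lemma area_rev c d p : area d c p = - area c d p.
Proof. rewrite /area; ring. Qed.

Lemma lexltNge p q : p != q -> lexlt q p = ~~ lexlt p q.
Proof.
case: p q => [p1 p2] [q1 q2]; rewrite /lexlt xpair_eqE /=.
by case: (ltgtP p1 q1) => //= _; case: (ltgtP p2 q2).
Qed.

Lemma lexlt_trans p q r : lexlt p q -> lexlt q r -> lexlt p r.
Proof.
rewrite /lexlt => /orP[h1|/andP[/eqP h1 k1]] /orP[h2|/andP[/eqP h2 k2]].
- by rewrite (lt_trans h1 h2).
- by rewrite -h2 h1.
- by rewrite h1 h2.
- by rewrite h1 h2 eqxx (lt_trans k1 k2) orbT.
Qed.

Lemma lexlt_le1 p q : lexlt p q -> p.1 <= q.1.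
Proof. by case/orP=> [/ltW//|/andP[/eqP->]]. Qed.

Lemma below_rev p c d : below p c d = below p d c.
Proof.
rewrite /below addbC; case: (eqVneq c d) => [->//|cd].
rewrite (lexltNge cd) area_rev oppr_gt0 oppr_lt0.
by case: (lexlt c d).
Qed.

Lemma belowxx p c : below p c c = false.
Proof. by rewrite /below addbb. Qed.

Lemma segments_meet a b c e : a.1 < b.1 ->
  a.1 <= c.1 <= b.1 -> a.1 <= e.1 <= b.1 ->
  0 <= area a b c -> area a b e <= 0 -> ~ disjoint_segments a b c e.
Proof.
move=> ab hc he Ac Ae H.
pose S := area a b c - area a b e.
pose m := if S == 0 then 0 else area a b c / S.
have S0 : 0 <= S by rewrite /S; lra.
have hm : 0 <= m <= 1.
  rewrite /m; case: eqVneq => [_|Sn]; first by lra.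
  have Sp : 0 < S by rewrite lt_neqAle eq_sym Sn.
  by rewrite divr_ge0 //= ler_pdivrMr // mul1r /S; lra.
have mS : area a b c = m * S.
  rewrite /m; case: eqVneq => [e0|Sn]; last by rewrite divfK.
  by move: e0; rewrite /S; lra.
pose q := (c.1 + m * (e.1 - c.1), c.2 + m * (e.2 - c.2)).
have Aq : (b.1 - a.1) * (q.2 - a.2) = (b.2 - a.2) * (q.1 - a.1).
  by move: mS; rewrite /S /area /q /=; lra.
have hq : a.1 <= q.1 <= b.1.
  case/andP: hm => m0 m1; case/andP: hc => c1 c2; case/andP: he => e1 e2.
  have h1 : 0 <= m * (e.1 - a.1) by rewrite mulr_ge0 ?subr_ge0.
  have h2 : 0 <= m * (b.1 - e.1) by rewrite mulr_ge0 ?subr_ge0.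
  have h3 : 0 <= (1 - m) * (c.1 - a.1) by rewrite mulr_ge0 ?subr_ge0.
  have h4 : 0 <= (1 - m) * (b.1 - c.1) by rewrite mulr_ge0 ?subr_ge0.
  rewrite /q /=; apply/andP; split; nra.
pose l := (q.1 - a.1) / (b.1 - a.1).
have ba : 0 < b.1 - a.1 by lra.
have hl : 0 <= l <= 1.
  case/andP: hq => aq qb.
  apply/andP; split; first by rewrite divr_ge0 ?subr_ge0 // ltW.
  by rewrite ler_pdivrMr // mul1r lerD2r.
have bn : b.1 - a.1 != 0 by rewrite gt_eqF.
have lE : l * (b.1 - a.1) = q.1 - a.1 by rewrite /l divfK.
apply: (H l m hl hm); rewrite -/q (surjective_pairing q); congr (_, _).
  by rewrite lE addrC subrK.
apply: (mulfI bn); rewrite mulrDr.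
have -> : (b.1 - a.1) * (l * (b.2 - a.2)) = (b.2 - a.2) * (q.1 - a.1).
  by rewrite -lE; ring.
by rewrite -Aq; ring.
Qed.

Lemma not_on_segment a b c d p : disjoint_segments a b c d ->
  (exists2 m, 0 <= m <= 1 & p = (c.1 + m * (d.1 - c.1), c.2 + m * (d.2 - c.2))) ->
  lexlt a p -> lexlt p b -> a.1 < b.1 /\ area a b p != 0.
Proof.
move=> H [m hm pE] ap pb.
have H' e : e = p -> disjoint_segments a b p e.
  move=> -> l k hl hk; rewrite !subrr !mulr0 !addr0 -surjective_pairing pE.
  exact: H.
have ap1 := lexlt_le1 ap; have pb1 := lexlt_le1 pb.
have ab : a.1 < b.1.
  rewrite lt_neqAle (le_trans ap1 pb1) andbT; apply/eqP => ab.
  have a1p : a.1 = p.1 by apply/le_anti; rewrite ap1 ab.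
  move: ap pb; rewrite /lexlt -a1p -ab ltxx eqxx /= => ap pb.
  have ba : 0 < b.2 - a.2 by lra.
  apply: (H' p erefl ((p.2 - a.2) / (b.2 - a.2)) 0).
  - apply/andP; split; last by rewrite ler_pdivrMr // mul1r lerD2r ltW.
    by apply: divr_ge0; lra.
  - by rewrite lexx ler01.
  - rewrite divfK ?gt_eqF // -ab !subrr !mulr0 !addr0 -a1p.
    by rewrite addrC subrK.
split=> //; apply/eqP => A0.
by apply: (segments_meet ab _ _ _ _ (H' p erefl)); rewrite ?A0 ?lexx ?ap1.
Qed.

Lemma segment_start c d : exists2 m, 0 <= m <= 1 &
  c = (c.1 + m * (d.1 - c.1), c.2 + m * (d.2 - c.2)).
Proof.
by exists 0; rewrite ?lexx ?ler01 // !mul0r !addr0 -surjective_pairing.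
Qed.

Lemma segment_end c d : exists2 m, 0 <= m <= 1 &
  d = (c.1 + m * (d.1 - c.1), c.2 + m * (d.2 - c.2)).
Proof.
exists 1; rewrite ?lexx ?ler01 // !mul1r.
by case: d => d1 d2 /=; congr (_, _); ring.
Qed.

Lemma disjoint_neq a b c d : disjoint_segments a b c d -> a != c.
Proof.
move=> H; apply/eqP => ac; apply: (H 0 0); rewrite ?lexx ?ler01 //.
by rewrite !mul0r !addr0 ac.
Qed.

Definition parity_form a b c d :=
  below a c d (+) below b c d (+) below c a b (+) below d a b (+)
  (lexlt c a (+) lexlt d a (+) lexlt c b (+) lexlt d b).

Lemma segments_same_side a b c d : disjoint_segments a b c d ->
  lexlt a c -> lexlt c b -> lexlt a d -> lexlt d b ->
  (0 < area a b c) = (0 < area a b d).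
Proof.
move=> H ac cb ad db.
have [ab Ac] := not_on_segment H (segment_start c d) ac cb.
have [_ Ad] := not_on_segment H (segment_end c d) ad db.
have hc : a.1 <= c.1 <= b.1 by rewrite !lexlt_le1.
have hd : a.1 <= d.1 <= b.1 by rewrite !lexlt_le1.
have H' : disjoint_segments a b d c.
  exact/disjoint_segmentsC/disjoint_segments_rev/disjoint_segmentsC.
case: (ltgtP 0 (area a b c)) Ac => // Ac _; case: (ltgtP 0 (area a b d)) Ad => // Ad _.
- by case: (segments_meet ab hc hd (ltW Ac) (ltW Ad) H).
- by case: (segments_meet ab hd hc (ltW Ad) (ltW Ac) H').
Qed.

Lemma segments_interleaved a b c d : disjoint_segments a b c d ->
  lexlt a c -> lexlt c b -> lexlt b d ->
  (0 < area a b c) = ~~ (0 < area c d b).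
Proof.
move=> H ac cb bd.
have [ab Ac] := not_on_segment H (segment_start c d) ac cb.
have [cd Ab] := not_on_segment (disjoint_segmentsC H) (segment_end a b) cb bd.
have ac1 := lexlt_le1 ac; have cb1 := lexlt_le1 cb; have bd1 := lexlt_le1 bd.
(* Compare ab and cd at both ends of the common range [c.1, b.1] of abscissae. *)
pose m := (b.1 - c.1) / (d.1 - c.1).
have dc : 0 < d.1 - c.1 by lra.
have mE : m * (d.1 - c.1) = b.1 - c.1 by rewrite divfK // gt_eqF.
have hm : 0 <= m <= 1.
  apply/andP; split; last by rewrite ler_pdivrMr // mul1r lerD2r.
  by apply: divr_ge0; lra.
pose e : F * F := (b.1, c.2 + m * (d.2 - c.2)).
have eE : (d.1 - c.1) * area a b e = - ((b.1 - a.1) * area c d b).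
  rewrite /area /e /=.
  have -> : (d.1 - c.1) * ((b.1 - a.1) * (c.2 + m * (d.2 - c.2) - a.2) -
       (b.2 - a.2) * (b.1 - a.1)) = (b.1 - a.1) * ((d.1 - c.1) * (c.2 - b.2) +
       (m * (d.1 - c.1)) * (d.2 - c.2)) by ring.
  by rewrite mE; ring.
have H' : disjoint_segments a b c e.
  move=> l k hl hk E; apply: (H l (k * m) hl).
    by case/andP: hk => k0 k1; case/andP: hm => m0 m1; rewrite mulr_ge0 //= mulr_ile1.
  by rewrite E /e /= -mE; congr (_, _); ring.
have H'' : disjoint_segments a b e c.
  exact/disjoint_segmentsC/disjoint_segments_rev/disjoint_segmentsC.
have hc : a.1 <= c.1 <= b.1 by rewrite ac1.
have he : a.1 <= e.1 <= b.1 by rewrite /e /= lexx ltW.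
have ba : 0 < b.1 - a.1 by lra.
case: (ltgtP 0 (area a b c)) Ac => // Ac _; case: (ltgtP 0 (area c d b)) Ab => // Ab _.
- case: (segments_meet ab hc he (ltW Ac) _ H').
  by rewrite -(pmulr_rle0 _ dc) eE oppr_le0 mulr_ge0 // ltW.
- case: (segments_meet ab he hc _ (ltW Ac) H'').
  by rewrite -(pmulr_rge0 _ dc) eE oppr_ge0 mulr_ge0_le0 // ltW.
Qed.

Lemma parity_form_ordered a b c d : disjoint_segments a b c d ->
  lexlt a b -> lexlt c d -> lexlt a c -> parity_form a b c d = false.
Proof.
move=> H ab cd ac.
have ad := lexlt_trans ac cd.
have nac := disjoint_neq H.
have nda : d != a.
  by rewrite (disjoint_neq (disjoint_segments_rev (disjoint_segmentsC H))).
have nbc := disjoint_neq (disjoint_segments_rev H).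
have nbd : b != d.
  have H' := disjoint_segments_rev (disjoint_segmentsC (disjoint_segments_rev H)).
  by rewrite eq_sym (disjoint_neq H').
have ca : lexlt c a = false by rewrite (lexltNge nac) ac.
have da : lexlt d a = false by rewrite lexltNge 1?eq_sym // ad.
rewrite /parity_form /below ab cd ac ad ca da /=.
rewrite (lexltNge nbc) (lexltNge nbd).
case bc: (lexlt b c) => /=.
  by rewrite (lexlt_trans bc cd).
case bd: (lexlt b d) => /=.
  have cb : lexlt c b by rewrite (lexltNge nbc) bc.
  by rewrite (segments_interleaved H ac cb bd); case: (0 < _).
have cb : lexlt c b by rewrite (lexltNge nbc) bc.
have db : lexlt d b by rewrite (lexltNge nbd) bd.
by rewrite (segments_same_side H ac cb ad db); case: (0 < _).
Qed.

Lemma parity_form_revl a b c d : parity_form b a c d = parity_form a b c d.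
Proof.
rewrite /parity_form !(below_rev _ b a).
by case: (below a c d); case: (below b c d); case: (below c a b);
  case: (below d a b); case: (lexlt c a); case: (lexlt d a);
  case: (lexlt c b); case: (lexlt d b).
Qed.

Lemma parity_form_revr a b c d : parity_form a b d c = parity_form a b c d.
Proof.
rewrite /parity_form !(below_rev _ d c).
by case: (below a c d); case: (below b c d); case: (below c a b);
  case: (below d a b); case: (lexlt c a); case: (lexlt d a);
  case: (lexlt c b); case: (lexlt d b).
Qed.

Lemma parity_formxx a c d : parity_form a a c d = false.
Proof.
by rewrite /parity_form !belowxx; case: (below a c d); case: (lexlt c a);
  case: (lexlt d a).
Qed.

Lemma parity_formC a b c d : a != c -> a != d -> b != c -> b != d ->
  parity_form c d a b = parity_form a b c d.
Proof.
move=> ac ad bc bd; rewrite /parity_form.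
rewrite (lexltNge ac) (lexltNge ad) (lexltNge bc) (lexltNge bd).
by case: (below a c d); case: (below b c d); case: (below c a b);
  case: (below d a b); case: (lexlt a c); case: (lexlt a d);
  case: (lexlt b c); case: (lexlt b d).
Qed.

Lemma parity_form_disjoint a b c d :
  disjoint_segments a b c d -> parity_form a b c d = false.
Proof.
have [->|nab] := eqVneq a b; first by rewrite parity_formxx.
wlog ab : a b nab / lexlt a b.
  move=> IH H; case ab: (lexlt a b); first exact: IH.
  rewrite -parity_form_revl; apply: IH (disjoint_segments_rev H).
    by rewrite eq_sym.
  by rewrite (lexltNge nab) ab.
have [->|ncd] := eqVneq c d.
  by rewrite /parity_form !belowxx; case: (below d a b); case: (lexlt d a);
    case: (lexlt d b).
wlog cd : c d ncd / lexlt c d.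
  move=> IH H; case cd: (lexlt c d); first exact: IH.
  rewrite -parity_form_revr; apply: IH; first by rewrite eq_sym.
    by rewrite (lexltNge ncd) cd.
  exact/disjoint_segmentsC/disjoint_segments_rev/disjoint_segmentsC.
move=> H; have nac := disjoint_neq H.
have nbc := disjoint_neq (disjoint_segments_rev H).
have H' := disjoint_segments_rev (disjoint_segmentsC H).
have nda := disjoint_neq H'.
have ndb := disjoint_neq (disjoint_segmentsC (disjoint_segments_rev (disjoint_segmentsC H'))).
case ac: (lexlt a c); first exact: parity_form_ordered.
rewrite -parity_formC //; [|by rewrite eq_sym..].
apply: parity_form_ordered (disjoint_segmentsC H) cd ab _.
by rewrite (lexltNge nac) ac.
Qed.
End Segments.

(** * Polygonal approximation of arcs *)

Section Sampling.
Local Open Scope classical_set_scope.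
Local Open Scope ring_scope.
Variable R : realType.

Lemma within_ball (f : R -> R) (s e : R) : {within `[0, 1], continuous f} ->
  `[0, 1]%classic s -> 0 < e ->
  exists2 d, 0 < d & forall x, 0 <= x <= 1 -> `|s - x| < d -> `|f s - f x| < e.
Proof.
move=> cf s01 e0.
have /cvgrPdist_lt /(_ e e0) := (subspace_continuousP _ _).1 cf s s01.
rewrite near_withinE /= => -[d d0 H]; exists d => // x x01 sx.
by apply: (H x); rewrite //= in_itv.
Qed.

Lemma convex_dist_le (u x y l e : R) : 0 <= l <= 1 ->
  `|u - x| <= e -> `|u - y| <= e -> `|u - (x + l * (y - x))| <= e.
Proof.
move=> /andP[l0 l1] hx hy.
have -> : u - (x + l * (y - x)) = (1 - l) * (u - x) + l * (u - y) by ring.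
rewrite (le_trans (ler_normD _ _)) // !normrM ger0_norm ?subr_ge0 // (ger0_norm l0).
have -> : e = (1 - l) * e + l * e by ring.
by rewrite lerD // ler_wpM2l // subr_ge0.
Qed.

Lemma disjoint_segments_coord (k : bool) (a b c d : R * R) (u v e : R) :
  let p (x : R * R) := if k then x.1 else x.2 in
  2 * e < `|u - v| ->
  `|u - p a| <= e -> `|u - p b| <= e -> `|v - p c| <= e -> `|v - p d| <= e ->
  disjoint_segments a b c d.
Proof.
move=> p uv ha hb hc hd l m l01 m01 E.
have {}E : p a + l * (p b - p a) = p c + m * (p d - p c).
  by rewrite /p; case: k {p ha hb hc hd} E => -[].
have := convex_dist_le l01 ha hb; have := convex_dist_le m01 hc hd.
rewrite E distrC => h1 h2; move: uv.
have := ler_distD (p c + m * (p d - p c)) u v.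
by move: h1 h2; lra.
Qed.

Lemma sampling_disjoint (f g : R -> R * R) :
  {within `[0, 1], continuous f} -> {within `[0, 1], continuous g} ->
  (forall s t, 0 <= s <= 1 -> 0 <= t <= 1 -> f s <> g t) ->
  exists N0 : nat, forall N, (N0 <= N)%N -> forall k l, (k < N)%N -> (l < N)%N ->
    disjoint_segments (f (k%:R / N%:R)) (f (k.+1%:R / N%:R))
                      (g (l%:R / N%:R)) (g (l.+1%:R / N%:R)).
Proof.
move=> cf cg fg.
have cp (h : R -> R * R) (k : bool) : {within `[0, 1], continuous h} ->
    {within `[0, 1], continuous (fun s => if k then (h s).1 else (h s).2)}.
  move=> ch; case: k => x.
    by apply: (@continuous_comp _ _ _ _ fst) => //; [exact: ch|exact: cvg_fst].
  by apply: (@continuous_comp _ _ _ _ snd) => //; [exact: ch|exact: cvg_snd].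
pose I01 : set R := `[0, 1]%classic.
have cI : compact (I01 `*` I01) by apply: compact_setX; exact: segment_compact.
pose P (N : nat) (x : R * R) := forall s s' t t' : R,
  [/\ 0 <= s <= 1, 0 <= s' <= 1, 0 <= t <= 1 & 0 <= t' <= 1] ->
  [/\ `|x.1 - s| <= N.+1%:R^-1, `|x.1 - s'| <= N.+1%:R^-1,
     `|x.2 - t| <= N.+1%:R^-1 & `|x.2 - t'| <= N.+1%:R^-1] ->
  disjoint_segments (f s) (f s') (g t) (g t').
have near_P x : (I01 `*` I01) x -> \forall x' \near x & N \near \oo, P N x'.
  case: x => s t [] /= s01 t01.
  have [k fgk] : exists k : bool,
      (if k then (f s).1 else (f s).2) != (if k then (g t).1 else (g t).2).
    move: (fg s t); rewrite /I01 /= !in_itv /= in s01 t01 * => /(_ s01 t01) /eqP.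
    rewrite [f s]surjective_pairing [g t]surjective_pairing xpair_eqE negb_and.
    by case/orP; [exists true|exists false].
  set u := (X in X != _) in fgk; set v := (X in _ != X) in fgk.
  have uv0 : 0 < `|u - v| by rewrite normr_gt0 subr_eq0.
  have e0 : 0 < `|u - v| / 3 by rewrite divr_gt0.
  have [d1 d10 H1] := within_ball (cp f k cf) s01 e0.
  have [d2 d20 H2] := within_ball (cp g k cg) t01 e0.
  pose d := Num.min d1 d2 / 2.
  have d0 : 0 < d by rewrite divr_gt0 // lt_min d10.
  have dd1 : d + d <= d1 by rewrite -splitr ge_min lexx.
  have dd2 : d + d <= d2 by rewrite -splitr ge_min lexx orbT.
  near=> x' N => s1 s2 t1 t2 [s101 s201 t101 t201] [h1 h2 h3 h4].
  have [b1 b2] : `|s - x'.1| < d /\ `|t - x'.2| < d.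
    have : ball (s, t) d x' by near: x'; exact: nbhsx_ballx.
    by case.
  have Nd : N.+1%:R^-1 < d.
    by near: N; exact: (@near_infty_natSinv_lt R (PosNum d0)).
  have close (y z w d' : R) : `|y - z| < d -> `|z - w| <= N.+1%:R^-1 -> d + d <= d' ->
      `|y - w| < d'.
    move=> yz zw; apply: lt_le_trans; apply: (le_lt_trans (ler_distD z y w)).
    by apply: ltrD yz _; exact: le_lt_trans zw Nd.
  apply: (@disjoint_segments_coord k _ _ _ _ u v (`|u - v| / 3)); first by lra.
  - by apply/ltW/H1 => //; exact: close h1 dd1.
  - by apply/ltW/H1 => //; exact: close h2 dd1.
  - by apply/ltW/H2 => //; exact: close h3 dd2.
  - by apply/ltW/H2 => //; exact: close h4 dd2.
have [N0 _ HN0] := (compact_near_coveringP _).1 cI nat \oo P _ near_P.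
exists N0.+1 => -[//|N] N0N k l kN lN.
have N0' : 0 < N.+1%:R :> R by rewrite ltr0n.
have frac (j : nat) : (j <= N.+1)%N -> 0 <= (j%:R / N.+1%:R : R) <= 1.
  move=> jN; rewrite divr_ge0 ?ler0n //= ler_pdivrMr // mul1r ler_nat //.
apply: (HN0 N _ (k%:R / N.+1%:R, l%:R / N.+1%:R)) => /=.
- by lia.
- by split; rewrite /I01 /= in_itv /= frac // ltnW.
- by split; apply: frac => //; exact: ltnW.
- have step (j : nat) : `|j%:R / N.+1%:R - j.+1%:R / N.+1%:R| <= N.+1%:R^-1 :> R.
    rewrite -mulrBl -natr1 opprD addNKr normrM normrN1 mul1r ger0_norm // invr_ge0 ltW.
  by split=> //; rewrite subrr normr0 invr_ge0 ltW.
Unshelve. all: by end_near. Qed.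
End Sampling.

Section Parity.
Variable R : realType.
Implicit Type G : sgraph.

Lemma xor_telescope (F : nat -> bool) n :
  \big[addb/false]_(k < n) (F k (+) F k.+1) = F 0 (+) F n.
Proof.
elim: n => [|n IH]; first by rewrite big_ord0 addbb.
by rewrite big_ord_recr /= IH; case: (F 0); case: (F n); case: (F n.+1).
Qed.

Definition frac (N k : nat) : R := (k%:R / N%:R)%R.

Definition polygon_below N (p : R * R) (f : R -> R * R) :=
  \big[addb/false]_(k < N) below p (f (frac N k)) (f (frac N k.+1)).

Lemma polygon_parity N (f g : R -> R * R) :
  (forall k l, (k < N)%N -> (l < N)%N ->
    disjoint_segments (f (frac N k)) (f (frac N k.+1))
                      (g (frac N l)) (g (frac N l.+1))) ->
  let a := f (frac N 0) in let b := f (frac N N) in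
  let c := g (frac N 0) in let d := g (frac N N) in
  polygon_below N a g (+) polygon_below N b g (+)
  (polygon_below N c f (+) polygon_below N d f) (+)
  (lexlt c a (+) lexlt d a (+) (lexlt c b (+) lexlt d b)) = false.
Proof.
move=> H a b c d.
pose p k := f (frac N k); pose q l := g (frac N l).
have S0 : \big[addb/false]_(k < N) \big[addb/false]_(l < N)
    parity_form (p k) (p k.+1) (q l) (q l.+1) = false.
  by apply: big1 => k _; apply: big1 => l _; apply/parity_form_disjoint/H.
have S1 : \big[addb/false]_(k < N) \big[addb/false]_(l < N)
    (below (p k) (q l) (q l.+1) (+) below (p k.+1) (q l) (q l.+1)) =
    polygon_below N a g (+) polygon_below N b g.
  rewrite -(xor_telescope (fun k => polygon_below N (p k) g)).
  by apply: eq_bigr => k _; rewrite big_split.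
have S2 : \big[addb/false]_(k < N) \big[addb/false]_(l < N)
    (below (q l) (p k) (p k.+1) (+) below (q l.+1) (p k) (p k.+1)) =
    polygon_below N c f (+) polygon_below N d f.
  rewrite exchange_big -(xor_telescope (fun l => polygon_below N (q l) f)).
  by apply: eq_bigr => k _; rewrite big_split.
have S3 : \big[addb/false]_(k < N) \big[addb/false]_(l < N)
    ((lexlt (q l) (p k) (+) lexlt (q l.+1) (p k)) (+)
     (lexlt (q l) (p k.+1) (+) lexlt (q l.+1) (p k.+1))) =
    lexlt c a (+) lexlt d a (+) (lexlt c b (+) lexlt d b).
  rewrite -(xor_telescope (fun k => lexlt c (p k) (+) lexlt d (p k))).
  apply: eq_bigr => k _; rewrite big_split /=.
  by rewrite (xor_telescope (fun l => lexlt (q l) (p k)))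
             (xor_telescope (fun l => lexlt (q l) (p k.+1))).
rewrite -S1 -S2 -S3 -!big_split -[RHS]S0 /=.
apply: eq_bigr => k _; rewrite -!big_split /=.
by apply: eq_bigr => l _; rewrite /parity_form !addbA.
Qed.

Lemma planar_parity G : planar R G ->
  exists (h : G -> G -> G -> bool) (o : rel G),
    (forall u v, u != v -> o v u = ~~ o u v) /\
    forall u v z w, edge u v -> edge z w ->
      u != z -> u != w -> v != z -> v != w ->
      h u z w (+) h v z w (+) (h z u v (+) h w u v) (+)
      (o z u (+) o w u (+) (o z v (+) o w v)) = false.
Proof.
case=> pos [gamma D].
have [Dinj Dc Di De Dr Dv Dx] := D.
have disj u v z w : edge u v -> edge z w -> u != z -> u != w -> v != z ->
    v != w -> forall s t : R, (0 <= s <= 1)%R -> (0 <= t <= 1)%R ->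
    gamma u v s <> gamma z w t.
  move=> uv zw uz uw vz vw s t s01 t01.
  have io (x : R) : (0 <= x <= 1)%R -> [\/ x = 0%R, x = 1%R | (0 < x < 1)%R].
    move=> /andP[x0 x1]; case: (eqVneq x 0%R) => [|n0]; first by constructor 1.
    case: (eqVneq x 1%R) => [|n1]; first by constructor 2.
    by constructor 3; rewrite lt_neqAle eq_sym n0 x0 lt_neqAle n1 x1.
  have [u0 v1] := De _ _ uv; have [z0 w1] := De _ _ zw.
  have pn x y : x != y -> pos x <> pos y by move=> xy /Dinj /eqP; exact/negP.
  have in01 (x : R) : (0 < x < 1)%R -> x \in (`]0%R, 1%R[%classic : set R).
    by move=> h; rewrite inE /= in_itv.
  case: (io s s01) => [->|->|/in01 si]; case: (io t t01) => [->|->|/in01 ti];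
    rewrite ?u0 ?v1 ?z0 ?w1; try exact: pn.
  - by move/esym; exact: (Dv _ _ _ zw _ ti).
  - by move/esym; exact: (Dv _ _ _ zw _ ti).
  - exact: (Dv _ _ _ uv _ si).
  - exact: (Dv _ _ _ uv _ si).
  - apply: (Dx _ _ _ _ uv zw _ _ _ si ti) => /setP /(_ u).
    by rewrite !inE eqxx (negPf uz) (negPf uw).
have samp (x : G * G * G * G) : exists N0 : nat, forall N, (N0 <= N)%N ->
    let: (u, v, z, w) := x in edge u v -> edge z w ->
      u != z -> u != w -> v != z -> v != w ->
    forall k l, (k < N)%N -> (l < N)%N ->
    disjoint_segments (gamma u v (frac N k)) (gamma u v (frac N k.+1))
                      (gamma z w (frac N l)) (gamma z w (frac N l.+1)).
  case: x => [[[u v] z] w].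
  have [[uv zw [uz [uw [vz vw]]]]|n] :=
    pselect [/\ edge u v, edge z w & [/\ u != z, u != w, v != z & v != w]]; last first.
    by exists 0 => N _ *; case: n.
  have [N0 H] := sampling_disjoint (Dc _ _ uv) (Dc _ _ zw)
    (disj _ _ _ _ uv zw uz uw vz vw).
  by exists N0 => N NN _ _ _ _ _ _; exact: H.
have [f Hf] := choice samp.
pose N := (\max_x f x).+1.
exists (fun p u v => polygon_below N (pos p) (gamma u v)).
exists (fun u v => lexlt (pos u) (pos v)); split.
  by move=> u v uv; rewrite lexltNge // (inj_eq Dinj).
move=> u v z w uv zw uz uw vz vw.
have NN : (f (u, v, z, w) <= N)%N by rewrite leqW // (leq_bigmax (u, v, z, w)).
have := polygon_parity (Hf (u, v, z, w) N NN uv zw uz uw vz vw).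
have [-> ->] : frac N 0 = 0%R /\ frac N N = 1%R.
  by rewrite /frac mul0r divff // pnatr_eq0.
by have [-> ->] := De _ _ uv; have [-> ->] := De _ _ zw.
Qed.
End Parity.

(** * Parity certificates of non-planarity *)

Definition antisym_below (o : nat -> nat -> bool) i j :=
  if i < j then o i j else ~~ o j i.

Definition pair_parity (h : nat -> nat -> nat -> bool) (o : nat -> nat -> bool)
    (q : (nat * nat) * (nat * nat)) : bool :=
  let: ((u, v), (z, w)) := q in let o' := antisym_below o in
  h u z w (+) h v z w (+) (h z u v (+) h w u v) (+)
       (o' z u (+) o' w u (+) (o' z v (+) o' w v)).

Definition order_term i j : bool * (bool * (nat * nat * nat)) :=
  if i < j then (false, (true, (i, j, 0))) else (true, (true, (j, i, 0))).

(* A term is a complementation flag followed by a key. *)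
Definition parity_terms (q : (nat * nat) * (nat * nat)) :=
  let: ((u, v), (z, w)) := q in
  [seq (false, (false, t)) | t <- [:: (u, z, w); (v, z, w); (z, u, v); (w, u, v)]]
  ++ [seq order_term t.1 t.2 | t <- [:: (z, u); (w, u); (z, v); (w, v)]].

Definition term_value (h : nat -> nat -> nat -> bool) (o : nat -> nat -> bool)
    (t : bool * (nat * nat * nat)) : bool :=
  let: (b, (i, j, k)) := t in if b then o i j else h i j k.

Definition odd_certificate (Q : seq ((nat * nat) * (nat * nat))) :=
  let T := flatten [seq parity_terms q | q <- Q] in
  let keys := [seq t.2 | t <- T] in
  odd (count (fun t => t.1) T) && all (fun t => ~~ odd (count_mem t keys)) keys.

Lemma xor_even (T : eqType) (F : T -> bool) (s : seq T) :
  all (fun t => ~~ odd (count_mem t s)) s -> \big[addb/false]_(t <- s) F t = false.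
Proof.
move=> /allP ev; rewrite -big_undup_iterop_count /= big_seq.
apply: big1 => t; rewrite mem_undup => /ev; move: (count_mem t s) => n.
rewrite Monoid.iteropE => /negPf nE.
have -> : iter n (addb (F t)) false = odd n && F t; last by rewrite nE.
by elim: n {nE} => //= n ->; case: (odd n); case: (F t).
Qed.

Lemma order_termE h o i j :
  antisym_below o i j = (order_term i j).1 (+) term_value h o (order_term i j).2.
Proof. by rewrite /antisym_below /order_term; case: ifP. Qed.

Lemma pair_parityE h o q : pair_parity h o q =
  \big[addb/false]_(t <- parity_terms q) (t.1 (+) term_value h o t.2).
Proof.
case: q => [[u v] [z w]]; rewrite /pair_parity !(order_termE h).
by rewrite unlock /= !addbF !addbA.
Qed.

Lemma xor_count (T : Type) (p : pred T) (s : seq T) :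
  \big[addb/false]_(t <- s) p t = odd (count p s).
Proof.
elim: s => [|t s IH]; first by rewrite big_nil.
by rewrite big_cons /= oddD IH; case: (p t).
Qed.

Lemma odd_certificateP h o Q : odd_certificate Q ->
  \big[addb/false]_(q <- Q) pair_parity h o q = true.
Proof.
case/andP=> oddT even; under eq_bigr do rewrite pair_parityE.
rewrite -(big_map parity_terms predT (fun s => \big[addb/false]_(t <- s) _)).
rewrite -big_flatten big_split /= -(big_map snd predT) (xor_even _ even) addbF.
by rewrite (xor_count (fun t => t.1)).
Qed.

Definition independent_pairs (E : seq (nat * nat)) :=
  [seq q <- [seq (e, f) | e <- E, f <- E] | let: ((u, v), (z, w)) := q in
    [&& u < z, u != w, v != z & v != w]].

Lemma nonplanar_parity (R : realType) (G : sgraph) (f : nat -> G) n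
    (Q : seq ((nat * nat) * (nat * nat))) :
  {in gtn n &, injective f} ->
  all (fun q : (nat * nat) * (nat * nat) => let: ((u, v), (z, w)) := q in
    [&& all (gtn n) [:: u; v; z; w], u != z, u != w, v != z & v != w] &&
    (edge (f u) (f v) && edge (f z) (f w))) Q ->
  odd_certificate Q -> ~ planar R G.
Proof.
move=> fI HQ sumQ /planar_parity [h [lt [ltN H]]].
pose h' i j k := h (f i) (f j) (f k); pose o' i j := lt (f i) (f j).
have := odd_certificateP h' o' sumQ.
suff -> : \big[addb/false]_(q <- Q) pair_parity h' o' q = false by [].
rewrite big_seq; apply: big1 => -[[u v] [z w]] /(allP HQ) /=.
case/andP=> Hq /andP[uv zw].
case/andP: Hq => /and5P[] un vn zn wn _ /and4P[uz uw vz vw].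
have ni i j : i < n -> j < n -> i != j -> f i != f j.
  by move=> ni nj; apply: contra_neq; exact: fI.
have ao i j : i < n -> j < n -> i != j -> antisym_below o' i j = lt (f i) (f j).
  move=> ni' nj ij; rewrite /antisym_below /o'; case: ltnP => // _.
  by rewrite ltN ?negbK // ni // eq_sym.
rewrite !ao // 1?eq_sym //.
by apply: H => //; apply: ni.
Qed.

Definition K5_edges :=
  [:: (0, 1); (0, 2); (0, 3); (0, 4); (1, 2); (1, 3); (1, 4); (2, 3); (2, 4); (3, 4)].
Definition K33_edges :=
  [:: (0, 3); (0, 4); (0, 5); (1, 3); (1, 4); (1, 5); (2, 3); (2, 4); (2, 5)].


(* K5 on 0, ..., 4 with the edge 24 subdivided by 6 and 5. *)
Definition subdivided_K5_pairs :=
  [seq q <- independent_pairs K5_edges | (q.1 != (2, 4)) && (q.2 != (2, 4))] ++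
  [seq (e, f) | e <- [:: (2, 6); (5, 6); (4, 5)], f <- [:: (0, 1); (0, 3); (1, 3)]].

(** * Attaching a vertex *)

Lemma planar_mono (R : realType) (G H : sgraph) (f : G -> H) :
  injective f -> (forall u v, edge u v -> edge (f u) (f v)) ->
  planar R H -> planar R G.
Proof.
move=> fI fE [pos [gamma [Dinj Dc Di De Dr Dv Dx]]].
exists (pos \o f), (fun u v => gamma (f u) (f v)); split=> //=.
- by move=> u v /Dinj /fI.
- by move=> u v /fE; exact: Dc.
- by move=> u v /fE; exact: Di.
- by move=> u v /fE; exact: De.
- by move=> u v /fE; exact: Dr.
- by move=> u v w /fE uv; exact: Dv.
- move=> u v u' v' /fE uv /fE uv' ne; apply: Dx uv uv' _ => E; apply: ne.
  apply: (imset_inj fI); apply: etrans (etrans E _); last apply/esym.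
    by rewrite imsetU !imset_set1.
  by rewrite imsetU !imset_set1.
Qed.

Lemma perm_map_lift (T U : eqType) (f : T -> U) (s : seq T) (t : seq U) :
  perm_eq (map f s) t -> exists2 r, perm_eq r s & t = map f r.
Proof.
case: s => [|x s] h.
  by exists [::] => //; apply/perm_nilP; rewrite perm_sym.
rewrite perm_sym in h; have [I hI tE] := perm_iotaP (f x) h.
rewrite size_map in hI; exists (map (nth x (x :: s)) I).
  apply: perm_trans (perm_map _ hI) _.
  by rewrite map_nth_iota0 ?take_size.
rewrite tE -map_comp; apply/eq_in_map => i.
by rewrite (perm_mem hI) mem_iota => /andP[_ iI]; exact: nth_map iI.
Qed.

Lemma realisation_enum (s : seq nat) (G : sgraph) : realisation s G ->
  exists2 e : seq G, perm_eq e (enum G) & s = map (@degree G) e.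
Proof. exact: perm_map_lift. Qed.

Lemma realisation_perm (s t : seq nat) (G : sgraph) :
  perm_eq s t -> realisation s G -> realisation t G.
Proof. by rewrite /realisation => st /perm_trans; apply. Qed.

Section Extension.
Variables (G : sgraph) (S : pred G).

Let someI : injective (@Some G).
Proof. by move=> x y []. Qed.

Definition ext_rel : rel (option G) := fun x y =>
  match x, y with
  | Some x, Some y => edge x y
  | Some x, None | None, Some x => S x
  | None, None => false
  end.

Lemma ext_rel_sym : symmetric ext_rel.
Proof. by case=> [x|] [y|] //=; exact: edge_sym. Qed.

Lemma ext_rel_irr : irreflexive ext_rel.
Proof. by case=> [x|] //=; exact: edge_irr. Qed.

Definition extension : sgraph := SGraph ext_rel_sym ext_rel_irr.

Lemma degree_extension_None : @degree extension None = #|S|.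
Proof.
rewrite /degree -[RHS](fintype.card_image someI S); apply: eq_card => -[x|] /=.
  by rewrite [RHS](fintype.mem_image someI S).
by rewrite !inE; apply/esym/negP => /mapP[].
Qed.

Lemma degree_extension_Some x : @degree extension (Some x) = degree x + S x.
Proof.
rewrite /degree (cardD1 None) !inE /= addnC; congr (_ + _).
rewrite -[RHS](fintype.card_image someI [pred y | edge x y]); apply: eq_card => -[y|] /=.
  by rewrite !inE /= [RHS](fintype.mem_image someI [pred y | edge x y]).
by rewrite !inE /=; apply/esym/negP => /mapP[].
Qed.

Lemma enum_extension (e : seq G) : perm_eq e (enum G) ->
  perm_eq (None :: map Some e) (enum extension).
Proof.
move=> he; apply: uniq_perm; last 1 first.
- move=> [x|]; rewrite mem_enum !inE //= (mem_map someI).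
  by rewrite (perm_mem he) mem_enum.
- rewrite /= map_inj_uniq ?(perm_uniq he) ?enum_uniq ?andbT; last exact: someI.
  by apply/mapP => -[].
- exact: enum_uniq.
Qed.

Lemma degree_sequence_extension (e : seq G) : perm_eq e (enum G) ->
  realisation (count S e :: [seq degree x + S x | x <- e]) extension.
Proof.
move=> he; rewrite /realisation /degree_sequence perm_sym.
apply: perm_trans (perm_map _ (enum_extension he)).
rewrite /= -map_comp degree_extension_None.
rewrite cardE /enum_mem size_filter.
have -> : count (mem S) (Finite.enum G) = count S e.
  by rewrite (permP he) enumT.
rewrite perm_cons perm_sym; under eq_map do rewrite /= degree_extension_Some.
exact: perm_refl.
Qed.

End Extension.

Definition attach (m : seq bool) (s : seq nat) : seq nat :=
  count id m :: [seq db.1 + db.2 | db : nat * bool <- zip s m].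

Lemma realisation_attach (m : seq bool) (s : seq nat) (G : sgraph) :
  size m = size s -> realisation s G ->
  exists S : pred G, realisation (attach m s) (extension S).
Proof.
move=> sm /realisation_enum [e he sE].
have ue : uniq e by rewrite (perm_uniq he) enum_uniq.
have se : size m = size e by rewrite sm sE size_map.
pose S x := nth false m (index x e).
have mE : m = map S e.
  apply: (@eq_from_nth _ false) => [|i im]; first by rewrite size_map.
  have x0 : G by case: (e) se im => [->|].
  by rewrite (nth_map x0) -?se // /S index_uniq // -se.
exists S; have := degree_sequence_extension S he.
rewrite /attach [in count id m]mE count_map; congr (realisation (_ :: _) _).
by rewrite [in zip _ m]mE sE zip_map -map_comp.
Qed.

Lemma degree_lt (G : sgraph) (x : G) : degree x < #|G|.
Proof.
rewrite /degree (cardD1 x G) ltnS; apply: subset_leq_card; apply/fintype.subsetP => y.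
by rewrite !inE andbT; apply: contraTneq => ->; rewrite edge_irr.
Qed.

(** * Degree-preserving switches *)

Section Switching.
Variable T : finType.
Implicit Type e : rel T.

Lemma card_exchange (A B : pred T) p q : p != q -> A p -> ~~ A q ->
  (forall y, B y = if y == p then false else if y == q then true else A y) ->
  #|B| = #|A|.
Proof.
move=> pq Ap Aq BE.
rewrite (cardD1 p A) (cardD1 q B) -!topredE /= BE eq_sym (negPf pq) eqxx Ap.
congr (_ + _); apply: eq_card => y; rewrite !inE -!topredE /= BE.
by case: eqVneq => [->|yq]; rewrite ?(negPf Aq) ?andbF //; case: eqVneq.
Qed.

Definition is_pair (u v x y : T) := (x == u) && (y == v) || (x == v) && (y == u).

(* Trades the edges wb and ac for the non-edges wa and bc. *)
Definition switch e w b c a : rel T := fun x y =>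
  if is_pair w b x y || is_pair a c x y then false
  else if is_pair w a x y || is_pair b c x y then true else e x y.

Lemma is_pair_sym u v x y : is_pair u v x y = is_pair u v y x.
Proof. by rewrite /is_pair orbC [(y == v) && _]andbC [(y == u) && _]andbC. Qed.

Lemma is_pair_irr u v x : u != v -> is_pair u v x x = false.
Proof.
move=> uv; rewrite /is_pair; case: eqVneq => [->|_] /=; last by rewrite andbF.
by rewrite (negPf uv).
Qed.

Lemma switch_sym e w b c a : symmetric e -> symmetric (switch e w b c a).
Proof.
by move=> es x y; rewrite /switch es !(is_pair_sym _ _ x).
Qed.

Lemma switch_irr e w b c a : irreflexive e ->
  uniq [:: w; b; c; a] -> irreflexive (switch e w b c a).
Proof.
move=> ei /=; rewrite !inE !negb_or !andbT => /and3P[/and3P[wb wc wa] /andP[bc ba] ca] x.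
by rewrite /switch !is_pair_irr ?ei // eq_sym.
Qed.

Lemma switch_row e w b c a y : w != b -> w != c -> w != a ->
  switch e w b c a w y = if y == b then false else if y == a then true else e w y.
Proof.
move=> wb wc wa; rewrite /switch /is_pair eqxx (negPf wb) (negPf wc) (negPf wa).
by rewrite !orbF.
Qed.

Lemma switch_degree e w b c a : symmetric e -> uniq [:: w; b; c; a] ->
  e w b -> e a c -> ~~ e w a -> ~~ e b c ->
  forall x, #|switch e w b c a x| = #|e x|.
Proof.
move=> es /=; rewrite !inE !negb_or !andbT => /and3P[/and3P[wb wc wa] /andP[bc ba] ca].
move=> ewb eac ewa ebc x.
have sE y : switch e w b c a x y =
    if x == w then if y == b then false else if y == a then true else e w y
    else if x == a then if y == c then false else if y == w then true else e a y
    else if x == b then if y == w then false else if y == c then true else e b y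
    else if x == c then if y == a then false else if y == b then true else e c y
    else e x y.
  rewrite /switch /is_pair.
  case: (eqVneq x w) => [->|xw] /=.
    by rewrite (negPf wb) (negPf wa) (negPf wc) !orbF /=.
  case: (eqVneq x a) => [->|xa] /=.
    by rewrite [a == b]eq_sym [a == c]eq_sym (negPf ba) (negPf ca) !orbF /=.
  case: (eqVneq x b) => [->|xb] /=.
    by rewrite (negPf bc) !orbF /=.
  by case: (eqVneq x c) => [->|xc] /=.
case: (eqVneq x w) sE => [->|xw] sE.
  by apply: (@card_exchange (e w) _ b a); rewrite // eq_sym.
case: (eqVneq x a) sE => [->|xa] sE.
  by apply: (@card_exchange (e a) _ c w); rewrite // 1?eq_sym // es.
case: (eqVneq x b) sE => [->|xb] sE.
  by apply: (@card_exchange (e b) _ w c); rewrite // es.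
case: (eqVneq x c) sE => [->|xc] sE.
  by apply: (@card_exchange (e c) _ a b); rewrite // 1?eq_sym // es.
by apply: eq_card => y; exact: sE.
Qed.

Lemma neighbours_switch e (w : T) (S : {set T}) :
  symmetric e -> irreflexive e -> w \notin S -> #|S| = #|e w| ->
  (forall a b, a \in S -> b \notin S -> b != w -> #|e b| <= #|e a|) ->
  exists e' : rel T, [/\ symmetric e', irreflexive e',
    forall x, #|e' x| = #|e x| & forall x, e' w x = (x \in S)].
Proof.
move: {2}#|[set x in S | ~~ e w x]| (leqnn #|[set x in S | ~~ e w x]|) => n.
elim: n e => [|n IH] e.
  rewrite leqn0 cards_eq0 => /eqP S0 es ei wS Sw _; exists e; split=> //.
  have sub : S \subset e w.
    apply/fintype.subsetP => x xS; apply/negPn/negP => ex.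
    by move/setP/(_ x): S0; rewrite !inE xS ex.
  by move=> x; have := subset_cardP Sw sub x.
move=> Hn es ei wS Sw top.
have [/eqP S0|/finset.set0Pn [a]] := boolP ([set x in S | ~~ e w x] == finset.set0).
  by apply: IH => //; rewrite S0 cards0.
rewrite inE => /andP[aS ewa].
have [b] : exists b, (b \in e w) && (b \notin S).
  apply/existsP; rewrite -[X in is_true X]negbK negb_exists; apply/negP => /forallP H.
  have sub : e w \subset S.
    by apply/fintype.subsetP => x ex; move: (H x); rewrite ex negbK.
  have := subset_cardP (esym Sw) sub a; rewrite aS => ea.
  by move: ewa; rewrite -topredE /= in ea *; rewrite ea.
case/andP=> ewb bS.
have ewb' : e w b by [].
have bw : b != w by apply: contraTneq ewb' => ->; rewrite ei.
have aw : a != w by apply: contraTneq aS => ->.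
have ab : a != b by apply: contraTneq aS => ->.
have [c] : exists c, [&& e a c, ~~ e b c & c != b].
  apply/existsP; rewrite -[X in is_true X]negbK negb_exists; apply/negP => /forallP H.
  have := top a b aS bS bw.
  rewrite (cardD1 b (e a)) (cardD1 w (e b)) (cardD1 a [predD1 e b & w]) !inE.
  rewrite -!topredE /= aw [e b w]es ewb' [e b a]es add1n ltn_add2l ltnNge.
  apply/negP; rewrite negbK.
  apply: subset_leq_card; apply/fintype.subsetP => x.
  rewrite !inE -!topredE /= => /andP[xb eax].
  move: (H x); rewrite xb eax /= andbT negbK => ->.
  have -> : x != w by apply: contraTneq eax => ->; rewrite es.
  by rewrite !andbT; apply: contraTneq eax => ->; rewrite ei.
case/and3P=> eac ebc cb.
have cw : c != w by apply: contraTneq eac => ->; rewrite es.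
have ca : c != a by apply: contraTneq eac => ->; rewrite ei.
have un : uniq [:: w; b; c; a].
  by rewrite /= !inE !negb_or ![w == _]eq_sym bw cw aw eq_sym cb [b == a]eq_sym ab ca.
have deg' := switch_degree es un ewb' eac ewa ebc.
have [||||||e' [es' ei' d' N']] := IH (switch e w b c a).
- have row := @switch_row e w b c a; rewrite ![w == _]eq_sym in row.
  have {}row y := row y bw cw aw.
  have H : [set x in S | ~~ switch e w b c a w x] \proper [set x in S | ~~ e w x].
    apply/properP; split.
      apply/fintype.subsetP => x; rewrite !inE row => /andP[xS]; rewrite xS.
      case: eqVneq => [xb|_]; first by rewrite -xb xS in bS.
      by case: eqVneq => [->|].
    by exists a; rewrite inE aS // row (negPf ab) eqxx.
  by rewrite -ltnS; exact: leq_trans (proper_card H) Hn.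
- exact: switch_sym.
- exact: switch_irr.
- exact: wS.
- by rewrite deg'.
- by move=> x y xS yS yw; rewrite !deg'; exact: top.
by exists e'; split=> // x; rewrite d' deg'.
Qed.
End Switching.

(** * Laying off a vertex *)

Section VertexDeletion.
Variables (G : sgraph) (w : G).

Definition deletion_rel : rel {x : G | x != w} := fun x y => edge (val x) (val y).

Lemma deletion_rel_sym : symmetric deletion_rel.
Proof. by move=> x y; exact: edge_sym. Qed.

Lemma deletion_rel_irr : irreflexive deletion_rel.
Proof. by move=> x; exact: edge_irr. Qed.

Definition deletion : sgraph := SGraph deletion_rel_sym deletion_rel_irr.

Lemma degree_deletion (x : deletion) :
  degree x = degree (val x : G) - edge w (val x).
Proof.
have -> : degree (val x : G) = edge w (val x) + degree x; last by rewrite addKn.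
rewrite /degree (cardD1 w) inE /= edge_sym; congr (_ + _).
rewrite -(fintype.card_image (@val_inj _ _ _) [pred y | edge x y]).
apply: eq_card => y; rewrite !inE /=; apply/idP/idP => [/andP[yw xy]|/fintype.imageP[z]].
  by apply/fintype.imageP; exists (Sub y yw : deletion); rewrite ?inE.
by rewrite inE /= => xz ->; rewrite (valP z).
Qed.

Lemma degree_sequence_deletion (r : seq G) : perm_eq (w :: r) (enum G) ->
  realisation [seq degree x - edge w x | x <- r] deletion.
Proof.
move=> hr; have [wr ur] : w \notin r /\ uniq r.
  by apply/andP; rewrite -cons_uniq (perm_uniq hr) enum_uniq.
have h : perm_eq [seq val x | x : deletion <- enum deletion] r.
  apply: uniq_perm => //; first by rewrite map_inj_uniq ?enum_uniq //; exact: val_inj.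
  move=> x; apply/mapP/idP => [[y _ ->]|xr].
    by have := perm_mem hr (val y); rewrite mem_enum !inE (negPf (valP y)).
  have xw : x != w by apply: contraNneq wr => <-.
  by exists (Sub x xw : deletion); rewrite ?mem_enum.
rewrite /realisation /degree_sequence (eq_map degree_deletion).
apply: perm_trans (perm_map (fun x : G => degree x - edge w x) h).
by rewrite -[X in perm_eq _ X]map_comp.
Qed.

End VertexDeletion.

Definition layoff (d : nat) (s : seq nat) := map predn (take d s) ++ drop d s.

Lemma graphical_layoff d s : sorted geq s -> graphical (d :: s) ->
  [/\ d <= size s, all (fun x => 0 < x) (take d s) & graphical (layoff d s)].
Proof.
move=> ss [G /realisation_enum [[//|w r] hr [dE sE]]].
have [wr ur] : w \notin r /\ uniq r.
  by apply/andP; rewrite -cons_uniq (perm_uniq hr) enum_uniq.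
have cG : #|G| = (size r).+1 by rewrite cardE -(perm_size hr).
have dr : d <= size r by rewrite dE -ltnS -cG degree_lt.
pose S : {set G} := [set x in take d r].
have wS : w \notin S by rewrite inE; apply: contra wr; exact: mem_take.
have cS : #|S| = #|@edge G w|.
  rewrite -/(degree w) -dE /S cardsE (card_uniqP _) ?take_uniq // size_takel //.
have [] := @neighbours_switch G (@edge G) w S (@edge_sym G) (@edge_irr G) wS cS.
  move=> a b; rewrite !inE => ad bd bw.
  have br : b \in drop d r.
    have := perm_mem hr b; rewrite mem_enum !inE (negPf bw) /=.
    by rewrite -{1}(cat_take_drop d r) mem_cat (negPf bd).
  have : sorted (relpre (@degree G) geq) r by rewrite -sorted_map -sE.
  rewrite sorted_pairwise; last by move=> x y z /= xy yz; exact: leq_trans yz xy.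
  rewrite -{1}(cat_take_drop d r) pairwise_cat => /and3P[/allrelP H _ _].
  exact: H ad br.
move=> e' [es ei de Nw].
pose G' := SGraph es ei.
have cG' x : @degree G' x = @degree G x by exact: de.
have R := @degree_sequence_deletion G' w r hr.
split; first by rewrite sE size_map.
  rewrite sE -map_take all_map; apply/allP => x xd /=; rewrite -cG'.
  by apply/card_gt0P; exists w; rewrite inE /= es Nw inE.
exists (deletion (w : G')); rewrite /layoff sE -map_take -map_drop -map_comp.
suff -> : [seq predn (degree x) | x <- take d r] ++ [seq degree x | x <- drop d r]
        = [seq @degree G' x - edge (w : G') x | x <- r] by [].
rewrite -{3}(cat_take_drop d r) map_cat; congr (_ ++ _); apply/eq_in_map => x xr.
  by rewrite cG' /= Nw inE xr subn1.
rewrite cG' /= Nw inE.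
suff /negPf -> : x \notin take d r by rewrite subn0.
move: ur; rewrite -{1}(cat_take_drop d r) cat_uniq => /and3P[_ /hasPn H _].
exact: H.
Qed.

Section SequenceClasses.
Variable R : realType.

Definition has_nonplanar s := exists2 G, realisation s G & ~ planar R G.

Definition has_cut s := exists2 G, realisation s G & ~ kconnected 3 G.

Lemma has_nonplanar_perm s t : perm_eq s t -> has_nonplanar s -> has_nonplanar t.
Proof. by move=> st [G sG nG]; exists G => //; exact: realisation_perm sG. Qed.

Lemma graphical_perm s t : perm_eq s t -> graphical s -> graphical t.
Proof. by move=> st [G sG]; exists G; exact: realisation_perm sG. Qed.

Lemma has_nonplanar_attach m s :
  size m = size s -> has_nonplanar s -> has_nonplanar (attach m s).
Proof.
move=> ms [G sG nG]; have [S HS] := realisation_attach ms sG.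
exists (extension S) => // pl; apply: nG.
by apply: (planar_mono (f := (Some : G -> extension S))) pl => // x y [].
Qed.

Lemma graphical_attach m s : size m = size s -> graphical s -> graphical (attach m s).
Proof.
move=> ms [G sG]; have [S HS] := realisation_attach ms sG.
by exists (extension S).
Qed.

Lemma zip_nseq (T U V : Type) (f : T * U -> V) (s : seq T) c :
  [seq f db | db <- zip s (nseq (size s) c)] = [seq f (d, c) | d <- s].
Proof. by elim: s => //= d s ->. Qed.

Lemma attach_cat u v s : size u = size v ->
  attach (u ++ nseq (size s) false) (v ++ s) =
  count id u :: [seq db.1 + db.2 | db : nat * bool <- zip v u] ++ s.
Proof.
move=> uv; rewrite /attach count_cat count_nseq mul0n addn0; congr (_ :: _).
rewrite zip_cat // map_cat zip_nseq; congr (_ ++ _).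
by rewrite -[RHS]map_id; apply: eq_map => x; exact: addn0.
Qed.

Definition attach_closed (P : seq nat -> Prop) :=
  (forall m s, size m = size s -> P s -> P (attach m s)) /\
  (forall s t, perm_eq s t -> P s -> P t).

Lemma has_nonplanar_closed : attach_closed has_nonplanar.
Proof. by split; [exact: has_nonplanar_attach|exact: has_nonplanar_perm]. Qed.

Lemma graphical_closed : attach_closed graphical.
Proof. by split; [exact: graphical_attach|exact: graphical_perm]. Qed.

Section Closed.
Variables (P : seq nat -> Prop) (cP : attach_closed P).

Lemma closed_attach u v s : size u = size v -> P (v ++ s) ->
  P (count id u :: [seq db.1 + db.2 | db : nat * bool <- zip v u] ++ s).
Proof.
move=> uv Ps; rewrite -attach_cat //; apply: (cP.1) Ps.
by rewrite !size_cat size_nseq uv.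
Qed.

Lemma closed_layoff d s :
  d <= size s -> all (leq 1) (take d s) -> P (layoff d s) -> P (d :: s).
Proof.
move=> ds /allP pos Ps; have := closed_attach (u := nseq d true) _ Ps.
rewrite size_nseq size_map size_takel // count_nseq mul1n => /(_ erefl).
have -> : [seq db.1 + db.2 | db : nat * bool <- zip [seq x.-1 | x <- take d s] (nseq d true)]
    = take d s.
  rewrite -{2}(size_takel ds) -(size_map predn) zip_nseq -map_comp.
  by rewrite map_id_in // => x /pos /= x0; rewrite addn1 prednK.
by rewrite cat_take_drop.
Qed.

Lemma closed_ear a b s : P [:: a, b & s] -> P [:: 3, 3, a.+2, b.+2 & s].
Proof.
move=> /(@closed_attach [:: true; true] [:: a; b] s erefl) /=.
move=> /(@closed_attach [:: true; true; true] [:: 2; a + 1; b + 1] s erefl) /=.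
by rewrite !addn1.
Qed.

Lemma closed_triangle a s : P (a :: s) -> P [:: 3, 3, 3, a + 3 & s].
Proof.
move=> /(@closed_attach [:: true] [:: a] s erefl) /=.
move=> /(@closed_attach [:: true; true] [:: 1; a + 1] s erefl) /=.
move=> /(@closed_attach [:: true; true; true] [:: 2; 2; a + 1 + 1] s erefl) /=.
by rewrite !addn1 addn3.
Qed.

Lemma closed_K4 s : P s -> P [:: 3, 3, 3, 3 & s].
Proof.
move=> /(@closed_attach [::] [::] s erefl) /=.
move=> /(@closed_attach [:: true] [:: 0] s erefl) /=.
move=> /(@closed_attach [:: true; true] [:: 1; 1] s erefl) /=.
by move=> /(@closed_attach [:: true; true; true] [:: 2; 2; 2] s erefl).
Qed.

End Closed.

Lemma has_cut_perm s t : perm_eq s t -> has_cut s -> has_cut t.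
Proof. by move=> st [G sG nG]; exists G => //; exact: realisation_perm sG. Qed.

(* The two new vertices of degree 3 are separated from the rest by the vertices
   of degrees a.+2 and b.+2. *)
Lemma has_cut_ear a b c s :
  graphical [:: a, b, c & s] -> has_cut [:: 3, 3, a.+2, b.+2, c & s].
Proof.
case=> G /realisation_enum [[//|x [//|y [//|z e]]] he [aE bE cE sE]].
have ue : uniq [:: x, y, z & e] by rewrite (perm_uniq he) enum_uniq.
pose S1 : pred G := pred2 x y.
pose G1 := extension S1.
pose S2 : pred G1 := fun u => if u is Some v then S1 v else true.
pose G2 := extension S2.
have he1 := enum_extension S1 he.
have ne : [/\ x != y, z != x & z != y] /\ {in e, forall t, (t != x) && (t != y)}.
  move: ue; rewrite /= !inE !negb_or => /and4P[/and3P[xy xz xe] /andP[yz ye] _ _].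
  by split=> [|t te]; rewrite ?(eq_sym z) //; apply/andP; split;
     apply: contraTneq te => ->.
case: ne => [[xy zx zy] ne].
exists G2.
  apply: realisation_perm (degree_sequence_extension S2 he1).
  have S1e : {in e, forall t, S1 t = false}.
    by move=> t /ne /andP[tx ty]; rewrite /S1 /= (negPf tx) (negPf ty).
  rewrite /= count_map -map_comp degree_extension_None !degree_extension_Some.
  have -> : count (preim Some S2) e = 0.
    by apply/eqP; rewrite -leqn0 leqNgt -has_count; apply/hasPn => t /S1e /= ->.
  have -> : [seq (fun u : G1 => degree u + S2 u) (Some t) | t <- e] = s.
    rewrite sE; apply/eq_in_map => t /S1e St.
    by rewrite degree_extension_Some /= St !addn0.
  rewrite card2 xy /S1 /= !eqxx (negPf zx) (negPf zy) orbT !addn0 !addn1.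
  by rewrite -aE -bE -cE.
pose X : {set G2} := [set (Some (Some x) : G2); (Some (Some y) : G2)].
move=> [_ /(_ X) H].
have : connect (@del_edge G2 X) None (Some (Some z)).
  apply: H; first by rewrite cards2; case: eqVneq.
    by rewrite !inE.
  rewrite !inE !negb_or; apply/andP; split; apply/eqP => -[]; exact/eqP.
have cl : fingraph.closed (@del_edge G2 X)
    (fun u : G2 => if u is Some (Some _) then false else true).
  apply: fingraph.intro_closed => [|u v] /=.
    by apply: sym_connect_sym => u v; rewrite /del_edge /= andbCA; congr [&& _, _ & _];
       exact: (@edge_sym G2).
  rewrite -!topredE /del_edge /= !inE => /and3P[]; case: u => [[u|]|]; case: v => [[v|]|] //=.
    by move=> _; rewrite !negb_or => /andP[] /eqP vx /eqP vy /orP[]/eqP E; subst.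
  by move=> _; rewrite !negb_or => /andP[] /eqP vx /eqP vy /orP[]/eqP E; subst.
by move=> /(fingraph.closed_connect cl).
Qed.

End SequenceClasses.

(** * Explicit non-planar realisations *)

Section ListGraph.
Variable W : seq (seq nat).

(* [nth [::] W i] lists the neighbours of i, but an edge need only be recorded
   at one of its ends. *)
Definition adj (i j : nat) :=
  (i != j) && ((j \in nth [::] W i) || (i \in nth [::] W j)).

Definition list_rel : rel 'I_(size W) := fun i j => adj i j.

Lemma adj_sym i j : adj i j = adj j i.
Proof. by rewrite /adj eq_sym orbC. Qed.

Lemma list_rel_sym : symmetric list_rel.
Proof. by move=> i j; exact: adj_sym. Qed.

Lemma list_rel_irr : irreflexive list_rel.
Proof. by move=> i; rewrite /list_rel /adj eqxx. Qed.

Definition list_graph : sgraph := SGraph list_rel_sym list_rel_irr.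

Definition list_degrees :=
  [seq count (adj i) (iota 0 (size W)) | i <- iota 0 (size W)].

Lemma degree_sequence_list_graph : degree_sequence list_graph = list_degrees.
Proof.
rewrite /degree_sequence /list_degrees -val_enum_ord -map_comp.
apply: eq_map => i; rewrite /degree /= cardE size_filter count_map enumT.
by apply: eq_count => j.
Qed.

Lemma realisation_list_graph s : perm_eq list_degrees s -> realisation s list_graph.
Proof. by rewrite /realisation degree_sequence_list_graph. Qed.

Definition has_pairs n (Q : seq ((nat * nat) * (nat * nat))) :=
  (n <= size W) &&
  all (fun q : (nat * nat) * (nat * nat) => let: ((u, v), (z, w)) := q in
    [&& all (gtn n) [:: u; v; z; w], u != z, u != w, v != z & v != w] &&
    (adj u v && adj z w)) Q.

Lemma list_graph_nonplanar (R : realType) n Q :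
  0 < n -> odd_certificate Q -> has_pairs n Q -> ~ planar R list_graph.
Proof.
move=> n0 oddQ /andP[nW HQ].
have W0 : 0 < size W := leq_trans n0 nW.
pose f (i : nat) : list_graph := insubd (Ordinal W0) i.
have fE i : i < n -> f i = i :> nat.
  by move=> ni; rewrite val_insubd (leq_trans ni nW).
apply: (@nonplanar_parity R list_graph f n Q) oddQ => [i j ni nj fij|].
  by rewrite -(fE i ni) -(fE j nj) fij.
apply: sub_all HQ => -[[u v] [z w]] /andP[H auv].
move: (H) => /andP[/and5P[un vn zn wn _ ] _].
by rewrite H /= /list_rel !fE.
Qed.

End ListGraph.

Definition nonplanar_witness W :=
  [|| has_pairs W 5 (independent_pairs K5_edges),
      has_pairs W 6 (independent_pairs K33_edges) |
      has_pairs W 7 subdivided_K5_pairs].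

Lemma nonplanar_witnessP (R : realType) W :
  nonplanar_witness W -> has_nonplanar R (sort geq (list_degrees W)).
Proof.
move=> H; exists (list_graph W).
  by apply: realisation_list_graph; rewrite perm_sym perm_sort.
by case/or3P: H; apply: list_graph_nonplanar.
Qed.

(* K5 is on 0, ..., 4, or K3,3 has the sides {0, 1, 2} and {3, 4, 5}, except in
   the first graph, the join of an edge and a 5-cycle. *)
Definition witnesses : seq (seq (seq nat)) := [::
  [:: [::]; [:: 0]; [:: 0; 1]; [:: 0; 1; 2]; [:: 0; 1; 3]; [:: 0; 1; 4]; [:: 0;
      1; 2; 5]];
  [:: [::]; [:: 0]; [:: 0; 1]; [:: 0; 1; 2]; [:: 0; 1; 2; 3]];
  [:: [::]; [:: 0]; [:: 0; 1]; [:: 0; 1; 2]; [:: 0; 1; 2]; [:: 0; 1; 2]];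
  [:: [::]; [:: 0]; [:: 0]; [:: 0; 1; 2]; [:: 0; 1; 2; 3]; [:: 0; 1; 2; 3]];
  [:: [::]; [:: 0]; [:: 0]; [:: 0; 1; 2]; [:: 0; 1; 2; 3]; [:: 0; 1; 2]];
  [:: [::]; [:: 0]; [:: 0]; [:: 0; 1; 2]; [:: 0; 1; 2]; [:: 0; 1; 2]];
  [:: [::]; [:: 0]; [::]; [:: 0; 1; 2]; [:: 0; 1; 2; 3]; [:: 0; 1; 2]];
  [:: [::]; [:: 0]; [::]; [:: 0; 1; 2]; [:: 0; 1; 2]; [:: 0; 1; 2]];
  [:: [::]; [::]; [::]; [:: 0; 1; 2]; [:: 0; 1; 2]; [:: 0; 1; 2]];
  [:: [::]; [:: 0]; [:: 0; 1]; [:: 0; 1; 2]; [:: 0; 1; 2]; [:: 0; 1; 2]; [:: 0; 1; 3]];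
  [:: [::]; [:: 0]; [:: 1]; [:: 0; 1; 2]; [:: 0; 1; 2; 3]; [:: 0; 1; 2]; [:: 0;
      2; 3; 5]];
  [:: [::]; [:: 0]; [:: 1]; [:: 0; 1; 2]; [:: 0; 1; 2; 3]; [:: 0; 1; 2]; [:: 0; 2; 5]];
  [:: [::]; [:: 0]; [:: 0; 1]; [:: 0; 1; 2]; [:: 0; 1; 2]; [:: 0; 1; 2]; [:: 0;
      1; 3]; [:: 0; 2; 3]];
  [:: [::]; [:: 0]; [:: 0]; [:: 0; 1; 2]; [:: 0; 1; 2]; [:: 0; 1; 2]; [:: 0; 1];
      [:: 0; 2; 6]];
  [:: [::]; [:: 0]; [::]; [:: 0; 1; 2]; [:: 0; 1; 2]; [:: 0; 1; 2]; [:: 0; 2];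
      [:: 0; 3; 6]];
  [:: [::]; [::]; [::]; [:: 0; 1; 2]; [:: 0; 1; 2]; [:: 0; 1; 2]; [:: 0; 1]; [::
      0; 2; 6]];
  [:: [::]; [::]; [::]; [:: 0; 1; 2]; [:: 0; 1; 2]; [:: 0; 1; 2]; [:: 2; 3]; [::
      0; 1; 6]];
  [:: [::]; [:: 0]; [:: 0]; [:: 0; 1; 2]; [:: 0; 1; 2]; [:: 0; 1; 2]; [:: 0; 1];
      [:: 0; 1]; [:: 0; 6; 7]];
  [:: [::]; [:: 0]; [:: 0]; [:: 0; 1; 2]; [:: 0; 1; 2]; [:: 0; 1; 2]; [:: 0];
      [:: 0; 1; 6]; [:: 0; 3; 6]];
  [:: [::]; [:: 0]; [:: 0; 1]; [:: 0; 1; 2]; [:: 0; 1; 2]; [:: 0; 1; 2]; [:: 0;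
      1; 3]; [:: 0; 2; 3]; [:: 1; 2; 3]];
  [:: [::]; [:: 0]; [::]; [:: 0; 1; 2]; [:: 0; 1; 2]; [:: 0; 1; 2]; [:: 0; 1];
      [:: 0; 1]; [:: 0; 6; 7]];
  [:: [::]; [::]; [::]; [:: 0; 1; 2]; [:: 0; 1; 2]; [:: 0; 1; 2]; [:: 0; 1]; [::
      0; 1]; [:: 0; 6; 7]];
  [:: [::]; [::]; [:: 0]; [:: 0; 1; 2]; [:: 0; 1; 2]; [:: 0; 1; 2]; [:: 0]; [::
      1; 6]; [:: 1; 6; 7]];
  [:: [::]; [::]; [::]; [:: 0; 1; 2]; [:: 0; 1; 2]; [:: 0; 1; 2]; [:: 0]; [:: 0;
      6]; [:: 1; 6; 7]];
  [:: [::]; [::]; [::]; [:: 0; 1; 2]; [:: 0; 1; 2]; [:: 0; 1; 2]; [:: 0]; [:: 1;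
      6]; [:: 2; 6; 7]];
  [:: [::]; [:: 0]; [:: 0]; [:: 0; 1; 2]; [:: 0; 1; 2]; [:: 0; 1; 2]; [:: 0; 1];
      [:: 0; 1]; [:: 0; 6]; [:: 0; 7; 8]];
  [:: [::]; [:: 0]; [:: 0]; [:: 0; 1; 2]; [:: 0; 1; 2]; [:: 0; 1; 2]; [:: 0];
      [:: 0; 6]; [:: 0; 6]; [:: 0; 7; 8]];
  [:: [::]; [:: 0]; [::]; [:: 0; 1; 2]; [:: 0; 1; 2]; [:: 0; 1; 2]; [:: 0; 1];
      [:: 0; 1]; [:: 0; 6]; [:: 0; 7; 8]];
  [:: [::]; [:: 0]; [::]; [:: 0; 1; 2]; [:: 0; 1; 2]; [:: 0; 1; 2]; [:: 0]; [::
      0; 6]; [:: 0; 6]; [:: 0; 7; 8]];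
  [:: [::]; [::]; [::]; [:: 0; 1; 2]; [:: 0; 1; 2]; [:: 0; 1; 2]; [:: 0; 1]; [::
      0; 1]; [:: 0; 6]; [:: 0; 7; 8]];
  [:: [::]; [::]; [::]; [:: 0; 1; 2]; [:: 0; 1; 2]; [:: 0; 1; 2]; [:: 0]; [:: 0;
      6]; [:: 0; 6]; [:: 0; 7; 8]];
  [:: [::]; [:: 0]; [::]; [:: 0; 1; 2]; [:: 0; 1; 2]; [:: 0; 1; 2]; [:: 0]; [::
      0; 1]; [:: 1; 6]; [:: 6; 7; 8]];
  [:: [::]; [::]; [::]; [:: 0; 1; 2]; [:: 0; 1; 2]; [:: 0; 1; 2]; [:: 0; 1]; [::
      0]; [:: 0; 7]; [:: 6; 7; 8]];
  [:: [::]; [:: 0]; [::]; [:: 0; 1; 2]; [:: 0; 1; 2]; [:: 0; 1; 2]; [::]; [:: 0;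
      6]; [:: 1; 6]; [:: 6; 7; 8]];
  [:: [::]; [::]; [::]; [:: 0; 1; 2]; [:: 0; 1; 2]; [:: 0; 1; 2]; [::]; [:: 0;
      6]; [:: 0; 6]; [:: 6; 7; 8]];
  [:: [::]; [::]; [::]; [:: 0; 1; 2]; [:: 0; 1; 2]; [:: 0; 1; 2]; [::]; [:: 0;
      6]; [:: 6]; [:: 6; 8]; [:: 7; 8; 9]];
  [:: [::]; [::]; [::]; [:: 0; 1; 2]; [:: 0; 1; 2]; [:: 0; 1; 2]; [::]; [:: 6];
      [:: 6; 7]; [:: 0; 1; 6]; [:: 0; 7; 8]];
  [:: [::]; [::]; [::]; [:: 0; 1; 2]; [:: 0; 1; 2]; [:: 0; 1; 2]; [:: 0]; [::
      0]; [:: 0; 6]; [:: 6; 7]; [:: 7; 8; 9]];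
  [:: [::]; [::]; [::]; [:: 0; 1; 2]; [:: 0; 1; 2]; [:: 0; 1; 2]; [:: 0; 1]; [::
      0]; [:: 0; 7]; [:: 1; 6]; [:: 7; 8; 9]];
  [:: [::]; [::]; [::]; [:: 0; 1; 2]; [:: 0; 1; 2]; [:: 0; 1; 2]; [:: 0]; [::
      0]; [:: 0; 7]; [:: 0; 1; 6]; [:: 6; 7; 8]];
  [:: [::]; [::]; [::]; [:: 0; 1; 2]; [:: 0; 1; 2]; [:: 0; 1; 2]; [:: 0]; [:: 0;
      6]; [:: 0; 6]; [:: 0; 7]; [:: 0; 8; 9]];
  [:: [::]; [:: 0]; [::]; [:: 0; 1; 2]; [:: 0; 1; 2]; [:: 0; 1; 2]; [:: 0]; [::
      0; 6]; [:: 0; 6]; [:: 0; 7]; [:: 0; 8; 9]];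
  [:: [::]; [::]; [::]; [:: 0; 1; 2]; [:: 0; 1; 2]; [:: 0; 1; 2]; [::]; [:: 6];
      [:: 6]; [:: 6; 7]; [:: 7; 8]; [:: 8; 9; 10]];
  [:: [::]; [::]; [::]; [:: 0; 1; 2]; [:: 0; 1; 2]; [:: 0; 1; 2]; [::]; [:: 1;
      6]; [:: 6]; [:: 0; 6]; [:: 7; 8]; [:: 8; 9; 10]];
  [:: [::]; [::]; [::]; [:: 0; 1; 2]; [:: 0; 1; 2]; [:: 0; 1; 2]; [::]; [:: 0;
      6]; [:: 6]; [:: 6; 8]; [:: 0; 7]; [:: 8; 9; 10]];
  [:: [::]; [::]; [::]; [:: 0; 1; 2]; [:: 0; 1; 2]; [:: 0; 1; 2]; [:: 0]; [::
      0]; [:: 0; 7]; [:: 6]; [:: 7; 8; 9]; [:: 1; 6; 9]];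
  [:: [::]; [::]; [::]; [:: 0; 1; 2]; [:: 0; 1; 2]; [:: 0; 1; 2]; [:: 0]; [:: 0;
      6]; [:: 0]; [:: 0; 8]; [:: 6; 7]; [:: 8; 9; 10]];
  [:: [::]; [::]; [::]; [:: 0; 1; 2]; [:: 0; 1; 2]; [:: 0; 1; 2]; [::]; [:: 6];
      [:: 6]; [:: 6; 8]; [:: 7]; [:: 8; 9; 10]; [:: 0; 7; 10]];
  [:: [::]; [:: 0]; [:: 0]; [:: 0; 1; 2]; [:: 0; 1; 2]; [:: 0; 1; 2]; [:: 0];
      [:: 0; 6]; [:: 0; 6]; [:: 0; 7]; [:: 0; 8; 9]]
].

Lemma witnesses_nonplanar : all nonplanar_witness witnesses.
Proof. by vm_compute. Qed.

Definition witness_sequences := [seq sort geq (list_degrees W) | W <- witnesses].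

(* [if] rather than [||], which [vm_compute] evaluates strictly. *)
Fixpoint nonplanar_by_reduction (fuel : nat) (s : seq nat) : bool :=
  if s \in witness_sequences then true else
  if fuel isn't k.+1 then false else
  let rec t := nonplanar_by_reduction k (sort geq t) in
  let n := size s in let d := last 0 s in let r := take n.-1 s in
  if (if [&& 0 < n, d <= size r & all (leq 1) (take d r)] then rec (layoff d r) else false)
  then true else
  if (if s is [:: a, b & r] then
        if [&& 2 <= a, 2 <= b & drop (size r - 2) r == [:: 3; 3]] then
          rec [:: a - 2, b - 2 & take (size r - 2) r] else false
      else false) then true else
  if s is a :: r then
    if (if (3 <= a) && (drop (size r - 3) r == [:: 3; 3; 3]) then
          rec (a - 3 :: take (size r - 3) r) else false) then true else
    if drop (n - 4) s == [:: 3; 3; 3; 3] then rec (take (n - 4) s) else false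
  else false.

Lemma nonplanar_by_reductionP (R : realType) fuel s :
  nonplanar_by_reduction fuel s -> has_nonplanar R s.
Proof.
have cP := has_nonplanar_closed R; have pP := @has_nonplanar_perm R.
elim: fuel s => [|k IH] s /=.
  case: ifP => // /mapP[W WW -> _]; apply: nonplanar_witnessP.
  exact: (allP witnesses_nonplanar).
case: ifP => [/mapP[W WW -> _]|_].
  by apply: nonplanar_witnessP; exact: (allP witnesses_nonplanar).
have rec t : nonplanar_by_reduction k (sort geq t) -> has_nonplanar R t.
  by move/IH; apply: pP; rewrite perm_sort.
case: ifP => [|_].
  case: ifP => // /and3P[n0 ds pos] /rec /(closed_layoff cP ds pos) Ps _.
  apply: pP Ps; rewrite -perm_rcons; case/lastP: s n0 {ds pos} => [//|t x] _.
  rewrite last_rcons size_rcons /=.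
  by have -> : take (size t) (rcons t x) = t by rewrite -cats1 take_size_cat.
case: ifP => [|_].
  case: s => [//|a [//|b r]]; case: ifP => // /and3P[a2 b2 /eqP rE] /rec.
  move/(closed_ear cP) => Ps _; apply: pP Ps.
  have [-> ->] : (a - 2).+2 = a /\ (b - 2).+2 = b by lia.
  rewrite -[X in perm_eq _ [:: _, _ & X]](cat_take_drop (size r - 2) r) rE.
  by rewrite -[[:: 3, 3, a, b & _]]/([:: 3; 3] ++ [:: a, b & _]) perm_catC.
case: s => [//|a r]; case: ifP => [|_].
  case: ifP => // /andP[a3 /eqP rE] /rec /(closed_triangle cP) Ps _.
  apply: pP Ps; rewrite subnK // -[X in perm_eq _ (_ :: X)](cat_take_drop (size r - 3) r) rE.
  by rewrite -[[:: 3, 3, 3, a & _]]/([:: 3; 3; 3] ++ a :: _) perm_catC.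
case: ifP => // /eqP rE /rec /(closed_K4 cP) Ps; apply: pP Ps.
rewrite -[X in perm_eq _ X](cat_take_drop ((size (a :: r)) - 4) (a :: r)) rE.
by rewrite -[[:: 3, 3, 3, 3 & _]]/([:: 3; 3; 3; 3] ++ _) perm_catC.
Qed.

(** * Sequences with at most ten terms *)

Lemma geq_total : total geq. Proof. by move=> m n; exact: leq_total. Qed.

Lemma geq_trans : transitive geq.
Proof. by move=> m n p /= mn pm; exact: leq_trans pm mn. Qed.

Fixpoint nongraphical_by_layoff (fuel : nat) (s : seq nat) : bool :=
  if fuel is k.+1 then
    if s is a :: r then
      if (a <= size r) && all (leq 1) (take a r)
      then nongraphical_by_layoff k (sort geq (layoff a r)) else true
    else false
  else false.

Lemma nongraphical_by_layoffP fuel s :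
  sorted geq s -> nongraphical_by_layoff fuel s -> ~ graphical s.
Proof.
elim: fuel s => [//|k IH] [//|a r] /= ss; have sr := path_sorted ss.
case: ifP => [_|/negP H _ /(graphical_layoff sr) [ds pos _]]; last first.
  by apply: H; rewrite ds.
move=> /IH H /(graphical_layoff sr) [_ _ gr]; apply: H.
  by apply: sort_sorted; exact: geq_total.
by apply: graphical_perm gr; rewrite perm_sym perm_sort.
Qed.

Fixpoint graphical_by_layoff (fuel : nat) (s : seq nat) : bool :=
  if s is a :: r then
    if fuel is k.+1 then
      if (a <= size r) && all (leq 1) (take a r)
      then graphical_by_layoff k (sort geq (layoff a r)) else false
    else false
  else true.

Lemma graphical_by_layoffP fuel s : graphical_by_layoff fuel s -> graphical s.
Proof.
elim: fuel s => [|k IH] [|a r] //=; try by exists (list_graph [::]);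
  apply: realisation_list_graph.
case: ifP => // /andP[ds pos] /IH gr; apply: closed_layoff ds pos _.
  exact: graphical_closed.
by apply: graphical_perm gr; rewrite perm_sort.
Qed.

Definition cut_by_ear (s : seq nat) :=
  if s is [:: a, b & r] then
    let r' := take (size r - 2) r in
    if [&& 2 <= a, 2 <= b, drop (size r - 2) r == [:: 3; 3] & 0 < size r'] then
      graphical_by_layoff (size s) (sort geq [:: a - 2, b - 2 & r'])
    else false
  else false.

Lemma cut_by_earP s : cut_by_ear s -> has_cut s.
Proof.
case: s => [//|a [//|b r]]; rewrite /cut_by_ear.
case: ifP => // /and4P[a2 b2 /eqP rE r0] /graphical_by_layoffP gr.
have {}gr : graphical [:: a - 2, b - 2 & take (size r - 2) r].
  by apply: graphical_perm gr; rewrite perm_sort.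
have rE' := cat_take_drop (size r - 2) r; rewrite rE in rE'.
case: (take _ _) gr r0 rE' => [//|c t] /has_cut_ear + _ rE'.
have [-> ->] : (a - 2).+2 = a /\ (b - 2).+2 = b by lia.
by apply: has_cut_perm; rewrite -rE' (perm_catC [:: 3; 3] [:: a, b, c & t]).
Qed.

Fixpoint descending (n hi : nat) : seq (seq nat) :=
  if n is m.+1 then
    flatten [seq [seq x :: t | t <- descending m x] | x <- iota 3 (hi - 2)]
  else [:: [::]].

Lemma mem_descending s hi : sorted geq s -> all (fun x => 3 <= x <= hi) s ->
  s \in descending (size s) hi.
Proof.
elim: s hi => [//|x s IH] hi /= ss /andP[/andP[x3 xhi] sall].
apply/flatten_mapP; exists x; first by rewrite mem_iota; lia.
apply: map_f; apply: IH; first exact: path_sorted ss.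
have := order_path_min geq_trans ss => /allP xs.
by apply/allP => y ys; have := allP sall y ys; have /= := xs y ys; lia.
Qed.

Definition small_ok s :=
  if nongraphical_by_layoff (size s) s then true else
  if nonplanar_by_reduction (size s) s then true else
  if cut_by_ear s then true else
  s \in [seq sort geq t | t <- forcibly_polyhedral_list].

Definition exceptional (s : seq nat) :=
  let p := size s in
  [|| s == [:: p.-1, nth 0 s 1 & nseq (p - 2) 3],
      s == [:: p.-1, p.-1, 4 & nseq (p - 3) 3] |
      s == [:: p.-1, p.-1, 4, 4 & nseq (p - 4) 3]].

Definition base_ok s :=
  if nongraphical_by_layoff (size s) s then true else
  if nonplanar_by_reduction (size s) s then true else exceptional s.

Lemma small_cases : all (fun p => all small_ok (descending p p.-1)) (iota 4 6).
Proof. by vm_compute. Qed.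

Lemma base_case : all base_ok (descending 10 9).
Proof. by vm_compute. Qed.

(** * Long sequences *)

Arguments nonplanar_by_reduction : simpl never.

Ltac perm_by_count :=
  apply/permP => ?; rewrite /= ?count_cat /= ?count_nseq /=; lia.

Lemma all_iota (p : pred nat) m n i : all p (iota m n) -> m <= i < m + n -> p i.
Proof. by move/allP=> H hi; apply: H; rewrite mem_iota. Qed.

Section Families.
Variables (P : seq nat -> Prop) (cP : attach_closed P).

Lemma ear_step x y t m : P [:: x, y & t ++ nseq m 3] ->
  P [:: x.+2, y.+2 & t ++ nseq m.+2 3].
Proof. by move/(closed_ear cP); apply: cP.2; perm_by_count. Qed.

Lemma triangle_step x t m : P (x :: t ++ nseq m 3) ->
  P (x + 3 :: t ++ nseq m.+3 3).
Proof. by move/(closed_triangle cP); apply: cP.2; perm_by_count. Qed.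

Lemma ear_family c t m k : P [:: c + m, c + m & t ++ nseq m 3] ->
  P [:: c + (m + k.*2), c + (m + k.*2) & t ++ nseq (m + k.*2) 3].
Proof.
move=> P0; elim: k => [|k]; first by rewrite addn0.
by move=> /ear_step; rewrite !doubleS !addnS.
Qed.

End Families.

Lemma graphical_sum_even s : graphical s -> ~~ odd (sumn s).
Proof.
move: {2}(size s) (leqnn (size s)) => n; elim: n s => [|n IH] s; first by case: s.
move=> sn gs; have : perm_eq s (sort geq s) by rewrite perm_sym perm_sort.
have : sorted geq (sort geq s) by apply: sort_sorted; exact: geq_total.
case: (sort geq s) => [|a r] ss ps.
  by rewrite (perm_sumn ps).
have [ar pos gr] := graphical_layoff (path_sorted ss) (graphical_perm ps gs).
have := IH _ _ gr; rewrite /layoff size_cat size_map -size_cat cat_take_drop.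
have := perm_size ps => /= sz; move: sn; rewrite sz ltnS => rn /(_ rn).
have e1 : sumn r = sumn (take a r) + sumn (drop a r).
  by rewrite -sumn_cat cat_take_drop.
have e2 : sumn (take a r) = sumn (map predn (take a r)) + a.
  rewrite -{3}(size_takel ar); elim: (take a r) pos => [//|x t IHt] /=.
  by case/andP=> x0 /IHt ->; lia.
by rewrite (perm_sumn ps) /= sumn_cat; lia.
Qed.

Section Induction.
Variable R : realType.
Let NP := has_nonplanar R.
Let cNP := has_nonplanar_closed R.

Lemma NP_reduce s fuel : nonplanar_by_reduction fuel (sort geq s) -> NP s.
Proof.
by move=> /(nonplanar_by_reductionP R); apply: cNP.2; rewrite perm_sort.
Qed.

Lemma nonplanar_family1 m a b : 8 <= m -> 3 <= a <= m -> 3 <= b <= m ->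
  ~~ odd (a + b + m) -> NP [:: a, b & nseq m 3].
Proof.
elim/ltn_ind: m a b => m IH a b m8 ha hb ev.
have [m12|m12] := ltnP m 12.
  have base : all (fun m => all (fun a => all (fun b =>
      odd (a + b + m) || nonplanar_by_reduction 20 (sort geq [:: a, b & nseq m 3]))
      (iota 3 (m - 2))) (iota 3 (m - 2))) (iota 8 4) by vm_compute.
  have := all_iota base (i := m); rewrite /= m8 => /(_ m12) /(all_iota (i := a)).
  move=> /(_ _) /(all_iota (i := b)) H.
  apply: (@NP_reduce _ 20); move: H; rewrite (negPf ev) /=; apply; lia.
have sw x y : NP [:: x, y & nseq m 3] -> NP [:: y, x & nseq m 3].
  by apply: cNP.2; perm_by_count.
have [m' mE] : exists m', m = m' + 4 by exists (m - 4); lia.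
have tri x y : 6 <= x <= m -> 3 <= y <= 4 -> ~~ odd (x + y + m) ->
    NP [:: x, y & nseq m 3].
  move=> hx hy ev'; have := @triangle_step _ cNP (x - 3) [:: y] (m' + 1).
  rewrite subnK; last by lia.
  by rewrite mE !addnS !addn0; apply; apply: IH; lia.
have [[a5 b5]|ab] : (5 <= a /\ 5 <= b) \/ (a <= 4 \/ b <= 4) by lia.
  have := @ear_step _ cNP (a - 2) (b - 2) [::] (m' + 2).
  have [-> ->] : (a - 2).+2 = a /\ (b - 2).+2 = b by lia.
  by rewrite mE !addnS !addn0; apply; apply: IH; lia.
have [a6|a6] := leqP 6 a; first by apply: tri; lia.
have [b6|b6] := leqP 6 b; first by apply: sw; apply: tri; lia.
have := closed_K4 cNP (IH m' _ a b _ _ _ _) => /(_ _ _ _ _ _) h.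
apply: (cNP.2 _ _ _ (h _ _ _ _ _)); try lia.
rewrite mE; perm_by_count.
Qed.

Lemma nonplanar_family4 m d : 6 <= m -> 4 <= d <= m.+1 -> ~~ odd d ->
  NP [:: m.+2, d, 4 & nseq m 3].
Proof.
elim/ltn_ind: m d => m IH d m6 hd ev.
have [m9|m9] := ltnP m 9.
  have base : all (fun m => all (fun d =>
      odd d || nonplanar_by_reduction 20 (sort geq [:: m.+2, d, 4 & nseq m 3]))
      (iota 4 (m - 2))) (iota 6 3) by vm_compute.
  have := all_iota base (i := m); rewrite /= m6 => /(_ m9) /(all_iota (i := d)).
  move=> H; apply: (@NP_reduce _ 20); move: H; rewrite (negPf ev) /=; apply; lia.
have [m' mE] : exists m', m = m' + 3 by exists (m - 3); lia.
have [d4|d6] : d = 4 \/ 6 <= d by lia.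
  have := @triangle_step _ cNP m'.+2 [:: d; 4] m'.
  by rewrite mE !addnS !addn0; apply; apply: IH; lia.
have := @ear_step _ cNP m'.+3 (d - 2) [:: 4] m'.+1.
have -> : (d - 2).+2 = d by lia.
by rewrite mE !addnS !addn0; apply; apply: IH; lia.
Qed.

Lemma nonplanar_family2 m : 5 <= m -> odd m -> NP [:: m.+2, m.+2, 5 & nseq m 3].
Proof.
move=> m5 om; have := @ear_family _ cNP 2 [:: 5] 5 (m - 5)./2.
have -> : 5 + (m - 5)./2.*2 = m by lia.
by apply; apply: (@NP_reduce _ 20); vm_compute.
Qed.

Lemma nonplanar_family3 m : 3 <= m -> odd m -> NP [:: m.+3, m.+3, 5, 4 & nseq m 3].
Proof.
move=> m3 om; have := @ear_family _ cNP 3 [:: 5; 4] 3 (m - 3)./2.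
have -> : 3 + (m - 3)./2.*2 = m by lia.
by apply; apply: (@NP_reduce _ 20); vm_compute.
Qed.

Lemma nonplanar_family5 m : 2 <= m -> ~~ odd m ->
  NP [:: m.+4, m.+4, 4, 4, 4 & nseq m 3].
Proof.
move=> m2 om; have := @ear_family _ cNP 4 [:: 4; 4; 4] 2 (m - 2)./2.
have -> : 2 + (m - 2)./2.*2 = m by lia.
by apply; apply: (@NP_reduce _ 20); vm_compute.
Qed.


Lemma sorted_geq_perm s t : sorted geq s -> sorted geq t -> perm_eq s t -> s = t.
Proof.
apply: (sorted_eq geq_trans) => x y /andP[xy yx]; apply/eqP; move: xy yx => /=.
by rewrite eqn_leq => -> ->.
Qed.

Lemma exceptionalP s : sorted geq s -> all (leq 3) s -> 5 <= size s ->
  exceptional s -> exists y j k,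
  [/\ s = [:: (size s).-1, y & nseq j 4 ++ nseq k 3], j + k + 2 = size s,
     3 <= y <= (size s).-1 & j = 0 \/ y = (size s).-1 /\ (j = 1 \/ j = 2)].
Proof.
move=> ss s3 s5 /or3P[] /eqP sE.
- exists (nth 0 s 1), 0, (size s - 2); split; [by []|by lia| |by left].
  case: s ss s3 s5 sE => [//|a [//|b q]] /= /andP[ab _] /and3P[_ b3 _] _ [aE _].
  by rewrite b3 -aE.
- by exists (size s).-1, 1, (size s - 3); split; [by []|by lia|by lia|by right; auto].
- by exists (size s).-1, 2, (size s - 4); split; [by []|by lia|by lia|by right; auto].
Qed.

Lemma count3_layoff d r : d <= size r -> all (leq d) r -> 4 <= d ->
  count (pred1 3) (layoff d r) <= 4.
Proof.
move=> dr /allP rd d4; rewrite /layoff count_cat count_map.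
have -> : count (pred1 3) (drop d r) = 0.
  apply/eqP; rewrite -leqn0 leqNgt -has_count; apply/hasPn => x /mem_drop /rd /=.
  by move: d4; clear; lia.
rewrite addn0; have [d5|d5] := ltnP 4 d; last first.
  apply: leq_trans (count_size _ _) _; rewrite size_takel //.
suff -> : count (preim predn (pred1 3)) (take d r) = 0 by [].
apply/eqP; rewrite -leqn0 leqNgt -has_count; apply/hasPn => x /mem_take /rd /=.
by move: d5; clear; lia.
Qed.

Lemma exceptional_layoff n a b c q y j k :
  10 <= n -> size q + 3 = n -> c <= b <= a -> all (geq c) q -> all (leq 3) q ->
  4 <= c -> ~~ odd (3 + a + b + c + sumn q) ->
  j + k + 2 = n -> 3 <= y <= n.-1 -> j = 0 \/ y = n.-1 /\ (j = 1 \/ j = 2) ->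
  perm_eq [:: n.-1, y & nseq j 4 ++ nseq k 3] [:: a.-1, b.-1, c.-1 & q] ->
  [/\ a = n, y = b.-1, perm_eq (nseq j 4 ++ nseq k 3) (c.-1 :: q) & c <= 5].
Proof.
move=> n10 szq /andP[cb ba] /allP qc /allP q3 c4 ev jk hy hj pt.
have c5 : c <= 5.
  rewrite leqNgt; apply/negP => c6; have := permP pt (leq 5).
  rewrite /= count_cat !count_nseq /=.
  by move: c6 cb ba hy n10; clear; lia.
have q5 x : x \in q -> x <= 5 by move=> /qc /= xc; exact: leq_trans xc c5.
have memt := perm_mem pt.
have tn x : x \in [:: n.-1, y & nseq j 4 ++ nseq k 3] -> x <= n.-1.
  rewrite !inE mem_cat !mem_nseq; move: n10 hy; clear.
  by move=> n10 hy /or4P[/eqP->|/eqP->|/andP[_ /eqP->]|/andP[_ /eqP->]]; lia.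
have an : a.-1 = n.-1.
  have h1 : a.-1 <= n.-1 by apply: tn; rewrite memt inE eqxx.
  have := memt n.-1; rewrite inE eqxx /= => /esym; rewrite !inE.
  move: h1 n10 c5 cb ba q5; clear => h1 n10 c5 cb ba q5.
  by move=> /or4P[/eqP e|/eqP e|/eqP e|/q5 e]; lia.
have pyT : perm_eq (y :: nseq j 4 ++ nseq k 3) [:: b.-1, c.-1 & q].
  by move: pt; rewrite an perm_cons.
have aE : a = n by move: an n10 c4 cb ba; clear; lia.
have sum_T : y + (j * 4 + k * 3) = b.-1 + (c.-1 + sumn q).
  by have := perm_sumn pyT; rewrite /= sumn_cat !sumn_nseq [4 * _]mulnC [3 * _]mulnC.
have yb : y = b.-1.
  have [y6|y5] := leqP 6 y.
    have : y \in [:: b.-1, c.-1 & q] by rewrite -(perm_mem pyT) inE eqxx.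
    rewrite !inE; move: y6 c5 q5; clear => y6 c5 q5.
    by move=> /or3P[/eqP //|/eqP e|/q5 e]; lia.
  have j0 : j = 0 by move: hj y5 n10; clear; lia.
  have : b.-1 \in [:: y & nseq j 4 ++ nseq k 3] by rewrite (perm_mem pyT) inE eqxx.
  rewrite inE mem_cat !mem_nseq j0 /= => /orP[/eqP //|/andP[_ /eqP b3]].
  have y4 : y <= 4.
    rewrite leqNgt; apply/negP => y4; have := permP pyT (leq 5).
    have q4 : count (leq 5) q = 0.
      apply/eqP; rewrite -leqn0 leqNgt -has_count; apply/hasPn => x /qc /=.
      by move: b3 cb; clear; lia.
    rewrite j0 /= !count_nseq b3 q4 /=.
    by move: y4 c5; clear; lia.
  have cE : c = 4 by move: b3 cb c4; clear; lia.
  move: ev sum_T; rewrite j0 aE cE.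
  by move: b3 y4 jk hy; rewrite j0; clear; lia.
split=> //.
by move: pyT; rewrite yb perm_cons.
Qed.

Lemma path_43 j k y : 4 <= y -> path geq y (nseq j 4 ++ nseq k 3).
Proof.
elim: j y => [|j IH] y y4 /=; last by rewrite y4 IH.
by elim: k y y4 => [//|k IH] y y4 /=; rewrite ltnW //; case: (k) => //= k'; elim: k'.
Qed.

Lemma exceptional_extension n b c q y j k :
  10 <= n -> 4 <= c -> c <= b -> ~~ odd (3 + n + b + c + sumn q) ->
  j + k + 2 = n -> 3 <= y <= n.-1 -> j = 0 \/ y = n.-1 /\ (j = 1 \/ j = 2) ->
  y = b.-1 -> perm_eq (nseq j 4 ++ nseq k 3) (c.-1 :: q) -> c <= 5 ->
  NP [:: 3, n, b, c & q] \/
  exists2 t, sorted geq t /\ exceptional t & perm_eq t [:: 3, n, b, c & q].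
Proof.
move=> n10 c4 cb ev jk hy hj yb pT c5.
have sT : j * 4 + k * 3 = c.-1 + sumn q.
  by have := perm_sumn pT; rewrite /= sumn_cat !sumn_nseq [4 * _]mulnC [3 * _]mulnC.
have bE : b = y.+1 by move: yb c4 cb; clear; lia.
have [cE|cE] : c = 4 \/ c = 5 by move: c4 c5; clear; lia.
  have ps : perm_eq [:: n, y.+1, 4 & nseq j 4 ++ nseq k 3] [:: 3, n, b, c & q].
    apply/permP => p; have := permP pT p; rewrite bE cE /=; clear; lia.
  case: hj => [j0|[yn [j1|j2]]].
  - rewrite j0 /= in ps; have [yn|yn] := eqVneq y.+1 n.
      right; exists [:: n, n, 4 & nseq k 3]; last by rewrite -{2}yn.
      have nE : n = k.+2 by move: jk j0; clear; lia.
      have n4 : 4 <= n by move: n10; clear; lia.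
      split; first by rewrite /= leqnn; apply: (@path_43 1 k).
      rewrite nE.
      by rewrite /exceptional /= size_nseq !subSS !subn0 eqxx !orbT.
    left; apply: cNP.2 ps _.
    have nE : n = k.+2 by move: jk j0; clear; lia.
    rewrite nE; apply: nonplanar_family4.
    + by move: nE n10; clear; lia.
    + by move: nE hy yn; clear; lia.
    + move: ev sT; rewrite j0 bE cE nE; clear; lia.
  - right; exists [:: n, y.+1, 4 & nseq j 4 ++ nseq k 3] => //.
    have -> : y.+1 = k.+3 by move: yn jk j1; clear; lia.
    have nE : n = k.+3 by move: jk j1; clear; lia.
    have n4 : 4 <= k.+3 by move: nE n10; clear; lia.
    rewrite nE j1; split; first by rewrite /= leqnn; apply: (@path_43 2 k).
    by rewrite /exceptional /= size_nseq !subSS !subn0 eqxx !orbT.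
  - left; apply: cNP.2 ps _; rewrite j2 /=.
    have nE : n = k.+4 by move: jk j2; clear; lia.
    have -> : y.+1 = k.+4 by move: nE yn; clear; lia.
    rewrite nE; apply: nonplanar_family5; first by move: nE n10; clear; lia.
    by move: ev sT; rewrite j2 bE cE yn nE; clear; lia.
left; case: hj => [j0|[yn [j1|j2]]].
- have := perm_mem pT 4; rewrite cE j0 /= mem_nseq !inE /=.
  by rewrite andbF.
- have pq : perm_eq (nseq k 3) q by move: pT; rewrite cE j1 perm_cons.
  have nE : n = k.+3 by move: jk j1; clear; lia.
  apply: (cNP.2 [:: k.+3, k.+3, 5 & nseq k.+1 3]).
    apply/permP => p; have := permP pq p.
    rewrite bE yn cE nE /= !count_nseq; clear; lia.
  apply: nonplanar_family2; first by move: nE n10; clear; lia.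
  by move: ev sT; rewrite j1 bE cE yn nE; clear; lia.
- have pq : perm_eq (4 :: nseq k 3) q by move: pT; rewrite cE j2 perm_cons.
  have nE : n = k.+4 by move: jk j2; clear; lia.
  apply: (cNP.2 [:: k.+4, k.+4, 5, 4 & nseq k.+1 3]).
    apply/permP => p; have := permP pq p.
    rewrite bE yn cE nE /= !count_nseq; clear; lia.
  apply: nonplanar_family3; first by move: nE n10; clear; lia.
  by move: ev sT; rewrite j2 bE cE yn nE; clear; lia.
Qed.

Lemma induction_step s : 11 <= size s -> sorted geq s -> all (leq 3) s ->
  graphical s ->
  (forall t, size t = (size s).-1 -> sorted geq t -> all (leq 3) t ->
    graphical t -> NP t \/ exceptional t) ->
  NP s \/ exceptional s.
Proof.
case: (lastP s) => [//|r d]; rewrite size_rcons ltnS => r10 ss s3 gs /= IH.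
have sr : sorted geq r by move: ss; rewrite -cats1 => /cat_sorted2[].
have psr : perm_eq (rcons r d) (d :: r) by rewrite perm_rcons.
have r3 : all (leq 3) r by move: s3; rewrite all_rcons => /andP[].
have d3 : 3 <= d by move: s3; rewrite all_rcons => /andP[].
have rd : all (leq d) r.
  move: ss; rewrite -cats1 sorted_pairwise; last exact: geq_trans.
  rewrite pairwise_cat => /and3P[/allrelP H _ _].
  by apply/allP => x xr; apply: (H _ _ xr); rewrite inE.
have [dr pos gL] := graphical_layoff sr (graphical_perm psr gs).
have NPL : NP (layoff d r) -> NP (rcons r d).
  by move/(closed_layoff cNP dr pos); apply: cNP.2; rewrite perm_sym.
have szL : size (layoff d r) = size r.
  by rewrite /layoff size_cat size_map -size_cat cat_take_drop.
set t := sort geq (layoff d r).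
have st : sorted geq t by apply: sort_sorted; exact: geq_total.
have pt : perm_eq t (layoff d r) by rewrite perm_sort.
have szt : size t = size r by rewrite size_sort.
have gt : graphical t by apply: graphical_perm gL; rewrite perm_sym.
have ev := graphical_sum_even gs.
have [a [b [c [q rE]]]] : exists a b c q, r = [:: a, b, c & q].
  by case: (r) r10 => [|a [|b [|c q]]] // _; exists a, b, c, q.
have [ba cb qc] : [/\ b <= a, c <= b & all (geq c) q].
  move: sr; rewrite rE /= => /and3P[-> -> cq]; split=> //.
  exact: (order_path_min geq_trans cq).
have r3' : [&& 3 <= a, 3 <= b, 3 <= c & all (leq 3) q] by move: r3; rewrite rE.
case/and4P: r3' => a3 b3 c3 q3.
have [d3'|d4] := leqP d 3; last first.
  have t3 : all (leq 3) t.
    rewrite (perm_all _ pt) /layoff all_cat all_map; apply/andP; split.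
      by apply/allP => x /mem_take /(allP rd) /=; move: d4; clear; lia.
    by apply/allP => x /mem_drop /(allP rd) /=; move: d4; clear; lia.
  have [NPt|] := IH t szt st t3 gt; first by left; apply: NPL; apply: cNP.2 NPt.
  move=> /(exceptionalP st t3) []; first by rewrite szt; move: r10; clear; lia.
  move=> y [j [k []]]; rewrite szt => tE jk hy hj.
  have := count3_layoff dr rd d4; rewrite -(permP pt) tE /= count_cat !count_nseq /=.
  by move: jk hj r10; clear; lia.
have {d3 d3'} dE : d = 3 by move: d3 d3'; clear; lia.
subst d; have LE : layoff 3 r = [:: a.-1, b.-1, c.-1 & q].
  by rewrite rE /layoff /= take0 drop0.
have [c4|c4] := leqP 4 c.
  have t3 : all (leq 3) t.
    by rewrite (perm_all _ pt) LE /= q3 andbT; move: c4 cb ba; clear; lia.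
  have [NPt|] := IH t szt st t3 gt; first by left; apply: NPL; apply: cNP.2 NPt.
  move=> /(exceptionalP st t3) []; first by rewrite szt; move: r10; clear; lia.
  move=> y [j [k []]]; rewrite szt => tE jk hy hj.
  have pt' := pt; rewrite LE tE in pt'.
  have ev' : ~~ odd (3 + a + b + c + sumn q).
    by move: ev; rewrite (perm_sumn psr) rE /= !addnA.
  have szq : size q + 3 = size r by rewrite rE /= !addnS addn0.
  have cba : c <= b <= a by rewrite cb ba.
  have [aE yb pT c5] := exceptional_layoff r10 szq cba qc q3 c4 ev' jk hy hj pt'.
  rewrite aE in ev'.
  have := exceptional_extension r10 c4 cb ev' jk hy hj yb pT c5.
  rewrite -aE -rE => -[NPs|[u [su eu] pu]].
    by left; apply: cNP.2 NPs; rewrite perm_sym.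
  right; suff -> : rcons r 3 = u by [].
  apply: sorted_geq_perm => //; rewrite perm_sym.
  by apply: perm_trans pu _; rewrite perm_sym.
have qE : q = nseq (size q) 3.
  apply/all_pred1P/allP => x xq /=; have := allP qc x xq; have /= := allP q3 x xq.
  by move: c4; clear => /=; lia.
have cE : c = 3 by move: c3 c4; clear; lia.
have sE : rcons r 3 = [:: a, b & nseq (size q).+2 3].
  rewrite rE cE {1}qE /=; congr [:: _, _, _ & _].
  by elim: (size q) => //= m ->.
have szs : size r = (size q).+3 by rewrite rE.
have an : a <= size r.
  have := gs; rewrite sE => gs'; have sE' : sorted geq (a :: b :: nseq (size q).+2 3).
    by rewrite -sE.
  have [+ _ _] := graphical_layoff (path_sorted sE') gs'.
  by rewrite /= size_nseq szs.
have [aE|an'] := eqVneq a (size r).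
  right; rewrite /exceptional sE /= size_nseq aE szs.
  by rewrite eqxx.
left; rewrite sE; apply: nonplanar_family1.
- by move: r10; rewrite szs; clear; lia.
- by move: an an' a3; rewrite szs; clear; lia.
- by move: ba an an' b3; rewrite szs; clear; lia.
- by move: ev; rewrite sE /= sumn_nseq; clear; lia.
Qed.

Theorem nonplanar_or_exceptional s : 10 <= size s -> sorted geq s ->
  all (leq 3) s -> graphical s -> NP s \/ exceptional s.
Proof.
move: {2}(size s) (erefl (size s)) => n; elim: n s => [|n IH] s sn s10 ss s3 gs.
  by rewrite sn in s10.
have [s11|s11] := leqP 11 (size s).
  apply: induction_step => // t; rewrite sn => tn; apply: IH => //.
  by rewrite tn -ltnS -sn.
have {}s10 : size s = 10 by move: s10 s11; clear; lia.
have s9 : all (fun x => 3 <= x <= 9) s.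
  case: s s10 ss s3 gs {sn s11} => [//|a r] [r9] ss s3 gs.
  have [ar _ _] := graphical_layoff (path_sorted ss) gs; rewrite r9 in ar.
  have am := order_path_min geq_trans ss.
  apply/allP => x xs; have /= -> := allP s3 x xs.
  by move: xs; rewrite inE => /orP[/eqP->//|/(allP am) /= xa]; exact: leq_trans xa ar.
have := mem_descending ss s9; rewrite s10 => /(allP base_case).
rewrite /base_ok; case: ifP => [/(nongraphical_by_layoffP ss)//|_].
by case: ifP => [/(nonplanar_by_reductionP R)|_]; [left|right].
Qed.

End Induction.

(** * Necessity *)

Lemma graphical_reduce s fuel : graphical_by_layoff fuel (sort geq s) -> graphical s.
Proof. by move=> /graphical_by_layoffP; apply: graphical_closed.2; rewrite perm_sort. Qed.

Lemma graphical_family1 m e : 3 <= m -> 1 <= e <= m.+1 -> odd e ->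
  graphical [:: m.+1, e & nseq m 3].
Proof.
elim/ltn_ind: m e => m IH e m3 he oe.
have [m6|m6] := ltnP m 6.
  have base : all (fun m => all (fun e =>
      ~~ odd e || graphical_by_layoff 20 (sort geq [:: m.+1, e & nseq m 3]))
      (iota 1 m.+1)) (iota 3 3) by vm_compute.
  have := all_iota base (i := m); rewrite m3 => /(_ m6) /(all_iota (i := e)) H.
  by apply: (@graphical_reduce _ 20); move: H; rewrite oe; apply; move: he; clear; lia.
have [m' mE] : exists m', m = m' + 3 by exists (m - 3); move: m6; clear; lia.
have [e1|e3] : e = 1 \/ 3 <= e by move: oe; clear; lia.
  have := @triangle_step _ graphical_closed m'.+1 [:: e] m'.
  rewrite mE !addnS !addn0; apply; apply: IH => //.
  - by move: mE; clear; lia.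
  - by move: mE m6; clear; lia.
  - by rewrite e1.
have := @ear_step _ graphical_closed m'.+2 (e - 2) [::] m'.+1.
have -> : (e - 2).+2 = e by move: e3; clear; lia.
rewrite mE !addnS !addn0; apply; apply: IH.
- by move: mE; clear; lia.
- by move: mE m6; clear; lia.
- by move: e3 he mE; clear; lia.
- by move: e3 oe; clear; lia.
Qed.

Lemma graphical_family2 k : 2 <= k -> ~~ odd k ->
  graphical [:: k.+2, k.+2, 4 & nseq k 3].
Proof.
move=> k2 ok; have := @ear_family _ graphical_closed 2 [:: 4] 2 (k - 2)./2.
have -> : 2 + (k - 2)./2.*2 = k by lia.
by apply; apply: (@graphical_reduce _ 20); vm_compute.
Qed.

Lemma graphical_family3 k : 2 <= k -> ~~ odd k ->
  graphical [:: k.+3, k.+3, 4, 4 & nseq k 3].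
Proof.
move=> k2 ok; have := @ear_family _ graphical_closed 3 [:: 4; 4] 2 (k - 2)./2.
have -> : 2 + (k - 2)./2.*2 = k by lia.
by apply; apply: (@graphical_reduce _ 20); vm_compute.
Qed.

Lemma exceptional_cut s : 10 <= size s -> sorted geq s -> all (leq 3) s ->
  graphical s -> exceptional s -> has_cut s.
Proof.
move=> s10 ss s3 gs es; have ev := graphical_sum_even gs.
have [|y [j [k [sE jk hy hj]]]] := exceptionalP ss s3 _ es.
  by move: s10; clear; lia.
have sum_s : sumn s = (size s).-1 + (y + (j * 4 + k * 3)).
  by rewrite {1}sE /= sumn_cat !sumn_nseq [4 * _]mulnC [3 * _]mulnC.
case: hj => [j0|[yn [j1|j2]]].
- have [k' kE] : exists k', k = k'.+3 by exists (k - 3); move: jk j0 s10; clear; lia.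
  have g : graphical [:: k'.+2, y - 2 & nseq k'.+1 3].
    apply: graphical_family1.
    + by move: jk j0 s10 kE; clear; lia.
    + by move: jk hy j0 kE s10; clear; lia.
    + by move: ev; rewrite sum_s -jk j0 kE; move: hy; clear; lia.
  apply: has_cut_perm (has_cut_ear g).
  have y2 : (y - 2).+2 = y by move: hy; clear; lia.
  rewrite sE -jk j0 kE y2 add0n addn2 /=.
  by apply/permP => p; rewrite /= !count_nseq; clear; lia.
- have [k' kE] : exists k', k = k'.+2 by exists (k - 2); move: jk j1 s10; clear; lia.
  have g : graphical [:: k'.+2, k'.+2, 4 & nseq k' 3].
    apply: graphical_family2.
    + by move: jk j1 s10 kE; clear; lia.
    + by move: ev; rewrite sum_s yn -jk j1 kE; clear; lia.
  apply: has_cut_perm (has_cut_ear g).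
  have n1 : (size s).-1 = k'.+4 by move: jk j1 kE; clear; lia.
  rewrite sE yn n1 j1 kE /=.
  by apply/permP => p; rewrite /= !count_nseq; clear; lia.
- have [k' kE] : exists k', k = k'.+2 by exists (k - 2); move: jk j2 s10; clear; lia.
  have g : graphical [:: k'.+3, k'.+3, 4, 4 & nseq k' 3].
    apply: graphical_family3.
    + by move: jk j2 s10 kE; clear; lia.
    + by move: ev; rewrite sum_s yn -jk j2 kE; clear; lia.
  apply: has_cut_perm (has_cut_ear g).
  have n1 : (size s).-1 = k'.+3.+2 by move: jk j2 kE; clear; lia.
  rewrite sE yn n1 j2 kE /=.
  by apply/permP => p; rewrite /= !count_nseq; clear; lia.
Qed.

Lemma kconnected_degree (k : nat) (G : sgraph) (x : G) :
  kconnected k G -> k <= degree x.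
Proof.
move=> [kG H]; rewrite leqNgt; apply/negP => dk.
pose X := [set y | edge x y].
have cX : #|X| < k by rewrite cardsE.
have xX : x \notin X by rewrite inE edge_irr.
have [y] : exists y, y \notin x |: X.
  apply/existsP; rewrite -[X in is_true X]negbK negb_exists; apply/negP => /forallP all.
  have : #|G| <= #|x |: X|.
    by apply: subset_leq_card; apply/fintype.subsetP => z _; move: (all z); rewrite negbK.
  by rewrite cardsU1 xX; lia.
rewrite !inE negb_or => /andP[yx exy].
have yX : y \notin X by rewrite inE.
have /connectP[[|z p] /=] := H X cX x y xX yX; first by move=> _ e; rewrite e eqxx in yx.
by rewrite /del_edge /= !inE => /andP[/and3P[_ exz xz]]; rewrite xz in exz.
Qed.

Lemma forcibly_polyhedral_sorted (R : realType) s : sorted geq s ->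
  forcibly_polyhedral R s ->
  s \in [seq sort geq t | t <- forcibly_polyhedral_list].
Proof.
move=> ss [gs fp].
have nNP : ~ has_nonplanar R s by move=> [G /fp [pG _]].
have nC : ~ has_cut s by move=> [G /fp [_ kG]].
have [s4 s3] : 4 <= size s /\ all (leq 3) s.
  have [G sG] := gs; have [_ kG] := fp G sG.
  have [e he sE] := realisation_enum sG.
  rewrite sE size_map (perm_size he) -cardE; split; first exact: kG.1.
  by rewrite all_map; apply/allP => x _ /=; exact: kconnected_degree.
have [s10|s9] := leqP 10 (size s).
  have [//|es] := nonplanar_or_exceptional R s10 ss s3 gs.
  by case: nC; exact: exceptional_cut.
have sp : all (fun x => 3 <= x <= (size s).-1) s.
  case: s {s9 s4 fp nNP nC} ss s3 gs => [//|a r] ss s3 gs.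
  have [ar _ _] := graphical_layoff (path_sorted ss) gs.
  have am := order_path_min geq_trans ss.
  apply/allP => x xs; have /= -> := allP s3 x xs.
  by move: xs; rewrite inE => /orP[/eqP->//|/(allP am) /= xa]; exact: leq_trans xa ar.
have hs : 4 <= size s < 4 + 6 by rewrite s4.
have := all_iota small_cases hs => /allP /(_ s (mem_descending ss sp)).
rewrite /small_ok; case: ifP => [/(nongraphical_by_layoffP ss)//|_].
case: ifP => [/(nonplanar_by_reductionP R)//|_].
by case: ifP => [/cut_by_earP|].
Qed.

Theorem forcibly_polyhedral_mem (R : realType) s : forcibly_polyhedral R s ->
  exists2 t, t \in forcibly_polyhedral_list & perm_eq s t.
Proof.
move=> [gs fp].
have ps : perm_eq (sort geq s) s by rewrite perm_sort.
have /mapP[t tL tE] : sort geq s \in [seq sort geq t | t <- forcibly_polyhedral_list].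
  apply: (@forcibly_polyhedral_sorted R).
    by apply: sort_sorted; exact: geq_total.
  split; first by apply: graphical_perm gs; rewrite perm_sym.
  by move=> G sG; apply: fp; exact: realisation_perm sG.
exists t => //; apply: perm_trans (_ : perm_eq s (sort geq s)) _.
  by rewrite perm_sym.
by rewrite tE perm_sort.
Qed.

(** * Straight-line drawings *)

Section StraightLineDrawing.
Variables (W : seq (seq nat)) (pos : seq (nat * nat)).
Local Notation n := (size W).
Local Notation p i := (nth (0, 0) pos i).

Definition area_pos (a b c : nat * nat) := b.1 * c.2 + a.1 * b.2 + a.2 * c.1.
Definition area_neg (a b c : nat * nat) := b.1 * a.2 + a.1 * c.2 + b.2 * c.1.

Definition ccw a b c := area_neg a b c < area_pos a b c.
Definition cw a b c := area_pos a b c < area_neg a b c.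

Definition separates a b c d :=
  [&& ~~ cw a b c, ~~ cw a b d & ccw a b c || ccw a b d] ||
  [&& ~~ ccw a b c, ~~ ccw a b d & cw a b c || cw a b d].

Definition straight_line_ok :=
  all (fun i => all (fun j => (i == j) || (p i != p j)) (iota 0 n)) (iota 0 n) &&
  all (fun i => all (fun j => ~~ adj W i j ||
    all (fun k => [|| k == i, k == j, ccw (p i) (p j) (p k) | cw (p i) (p j) (p k)])
      (iota 0 n) &&
    all (fun k => all (fun l => [|| ~~ adj W k l, (k == i) && (l == j),
        (k == j) && (l == i), separates (p i) (p j) (p k) (p l) |
        separates (p k) (p l) (p i) (p j)])
      (iota 0 n)) (iota 0 n)) (iota 0 n)) (iota 0 n).

Variable R : realType.
Local Open Scope ring_scope.

Definition embed (a : nat * nat) : R * R := (a.1%:R, a.2%:R).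

Definition segment (a b : R * R) (t : R) : R * R :=
  (a.1 + t * (b.1 - a.1), a.2 + t * (b.2 - a.2)).

Lemma area_embed a b c :
  area (embed a) (embed b) (embed c) = (area_pos a b c)%:R - (area_neg a b c)%:R.
Proof. by rewrite /area /area_pos /area_neg /embed /= !natrD !natrM; ring. Qed.

Lemma ccwE a b c : ccw a b c = (0 < area (embed a) (embed b) (embed c)).
Proof. by rewrite area_embed subr_gt0 ltr_nat. Qed.

Lemma cwE a b c : cw a b c = (area (embed a) (embed b) (embed c) < 0).
Proof. by rewrite area_embed subr_lt0 ltr_nat. Qed.

Lemma area_segment (a b c d : R * R) t :
  area a b (segment c d t) = (1 - t) * area a b c + t * area a b d.
Proof. by rewrite /area /segment /=; ring. Qed.

Lemma area_on_segment (a b : R * R) t : area a b (segment a b t) = 0.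
Proof. by rewrite /area /segment /=; ring. Qed.

Lemma separates_disjoint a b c d s t : separates a b c d ->
  0 < t < 1 ->
  segment (embed a) (embed b) s <> segment (embed c) (embed d) t.
Proof.
rewrite /separates !cwE !ccwE -!leNgt => H /andP[t0 t1] E.
have := area_on_segment (embed a) (embed b) s; rewrite E area_segment => A0.
have t1' : 0 < 1 - t by rewrite subr_gt0.
set x := area _ _ (embed c) in H A0; set y := area _ _ (embed d) in H A0.
case/orP: H => /and3P[x0 y0 /orP[h|h]]; nra.
Qed.

Lemma straight_line_planar : straight_line_ok -> planar R (list_graph W).
Proof.
case/andP=> Hinj Hedge.
have inj i j : (i < n)%N -> (j < n)%N -> p i = p j -> i = j.
  move=> ni nj pij; move/allP: Hinj => /(_ i); rewrite mem_iota => /(_ ni) /allP /(_ j).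
  by rewrite mem_iota pij eqxx orbF => /(_ nj) /eqP.
have He i j : (i < n)%N -> (j < n)%N -> adj W i j ->
    (forall k, (k < n)%N -> k != i -> k != j ->
       ccw (p i) (p j) (p k) || cw (p i) (p j) (p k)) /\
    (forall k l, (k < n)%N -> (l < n)%N -> adj W k l -> ~~ ((k == i) && (l == j)) ->
      ~~ ((k == j) && (l == i)) ->
      separates (p i) (p j) (p k) (p l) || separates (p k) (p l) (p i) (p j)).
  move=> ni nj aij; move/allP: Hedge => /(_ i); rewrite mem_iota => /(_ ni) /allP /(_ j).
  rewrite mem_iota aij => /(_ nj) /andP[/allP H1 /allP H2]; split.
    by move=> k nk ki kj; have := H1 k; rewrite mem_iota (negPf ki) (negPf kj); apply.
  move=> k l nk nl akl h1 h2; have := H2 k; rewrite mem_iota => /(_ nk) /allP /(_ l).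
  by rewrite mem_iota akl (negPf h1) (negPf h2); apply.
pose q (u : list_graph W) := embed (p u).
have qI : injective q.
  move=> u v [] /eqP; rewrite eqr_nat => /eqP e1 /eqP; rewrite eqr_nat => /eqP e2.
  apply: val_inj; apply: inj; [exact: ltn_ord|exact: ltn_ord|].
  by move: e1 e2; case: (p u) (p v) => ? ? [? ?] /= -> ->.
have segI (a b : R * R) s t : a != b -> segment a b s = segment a b t -> s = t.
  move=> ab [] /addrI e1 /addrI e2.
  have : (b.1 - a.1 != 0) || (b.2 - a.2 != 0).
    rewrite -negb_and !subr_eq0; apply: contra ab => /andP[/eqP h1 /eqP h2].
    by rewrite (surjective_pairing a) (surjective_pairing b) h1 h2.
  by case/orP=> h; apply: (mulIf h).
have seg0 (a b : R * R) : segment a b 0 = a.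
  by rewrite /segment !mul0r !addr0 -surjective_pairing.
have seg1 (a b : R * R) : segment a b 1 = b.
  by rewrite /segment !mul1r ![a.1 + _]addrC ![a.2 + _]addrC !subrK -surjective_pairing.
have quv (u v : list_graph W) : edge u v -> q u != q v.
  by move=> uv; apply: contraTneq uv => /qI ->; rewrite edge_irr.
exists q, (fun u v => segment (q u) (q v)); split.
- exact: qI.
- move=> u v _; apply: continuous_subspaceT => t.
  have lin (a b : R) : ((a + x * b) @[x --> t] --> a + t * b)%classic.
    by apply: cvgD; [exact: cvg_cst|apply: cvgM; [exact: cvg_id|exact: cvg_cst]].
  exact: (cvg_pair (lin (q u).1 ((q v).1 - (q u).1)) (lin (q u).2 ((q v).2 - (q u).2))).
- by move=> u v uv s t _ _; apply: segI; exact: quv.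
- by move=> u v _; rewrite seg0 seg1.
- by move=> u v _ t _; rewrite /segment; congr (_, _); ring.
- move=> u v w uv t; rewrite inE /= in_itv /= => /andP[t0 t1] E.
  case: (eqVneq w u) => [wu|wu].
    have : t = 0 by apply: (segI (q u) (q v)); rewrite ?quv // E seg0 wu.
    by move=> t00; rewrite t00 ltxx in t0.
  case: (eqVneq w v) => [wv|wv].
    have : t = 1 by apply: (segI (q u) (q v)); rewrite ?quv // E seg1 wv.
    by move=> t11; rewrite t11 ltxx in t1.
  have [H _] := He u v (ltn_ord u) (ltn_ord v) uv.
  have := H w (ltn_ord w) wu wv; rewrite ccwE cwE -/(q u) -/(q v) -/(q w) -E.
  by rewrite area_on_segment ltxx.
- move=> u v u' v' uv uv' ne t t'; rewrite !inE /= !in_itv /= => ht ht'.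
  have [_ H] := He u v (ltn_ord u) (ltn_ord v) uv.
  have := H u' v' (ltn_ord u') (ltn_ord v') uv' _ _.
  case/(_ _ _)/orP.
  + by apply/negP => /andP[/eqP/val_inj e1 /eqP/val_inj e2]; apply: ne; rewrite e1 e2.
  + apply/negP => /andP[/eqP/val_inj e1 /eqP/val_inj e2]; apply: ne; rewrite e1 e2.
    by rewrite finset.setUC.
  + by move=> /separates_disjoint; apply.
  + by move=> /separates_disjoint S /esym; exact: S.
Qed.

End StraightLineDrawing.

(** * Realisations of the eight sequences *)

Section Connectivity.
Variable W : seq (seq nat).
Local Notation n := (size W).

Definition remaining u v := [seq i <- iota 0 n | (i != u) && (i != v)].

Definition reach_step u v (S : seq nat) :=
  [seq j <- remaining u v | (j \in S) || has (adj W j) S].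

Definition connected_without u v :=
  if remaining u v is r :: _ then
    all (fun i => i \in iter n (reach_step u v) [:: r]) (remaining u v)
  else true.

Definition three_connected :=
  (3 < n) && all (fun u => all (connected_without u) (iota 0 n.+1)) (iota 0 n.+1).

Lemma three_connectedP : three_connected -> kconnected 3 (list_graph W).
Proof.
case/andP=> n3 /allP H; split; first by rewrite card_ord.
move=> X X3.
have [u [v [un vn XE]]] : exists u v, [/\ u <= n, v <= n &
    forall i : 'I_n, (i \in X) = (i == u :> nat) || (i == v :> nat)].
  have [/cards0_eq ->|X0] := posnP #|X|.
    by exists n, n; split=> // i; rewrite inE orbb ltn_eqF.
  have [X1|X1] := eqVneq #|X| 1.
    have /cards1P[x ->] : #|X| == 1 by rewrite X1.
    exists x, x; split; [exact/ltnW/ltn_ord|exact/ltnW/ltn_ord|].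
    by move=> i; rewrite !inE orbb.
  have /cards2P[x [y [xy ->]]] : #|X| == 2 by rewrite eqn_leq -ltnS X3 ltn_neqAle eq_sym X1.
  exists x, y; split; [exact/ltnW/ltn_ord|exact/ltnW/ltn_ord|].
  by move=> i; rewrite !inE.
have := H u; rewrite mem_iota => /(_ un) /allP /(_ v); rewrite mem_iota => /(_ vn).
rewrite /connected_without.
have remE (i : 'I_n) : ((i : nat) \in remaining u v) = (i \notin X).
  by rewrite mem_filter mem_iota /= ltn_ord andbT XE negb_or.
have csym : connect_sym (@del_edge (list_graph W) X).
  apply: sym_connect_sym => a b; rewrite /del_edge /= andbCA.
  by congr [&& _, _ & _]; exact: (@edge_sym (list_graph W)).
case rE: (remaining u v) => [|r rs]; first by move=> _ x y; rewrite -remE rE.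
have rr : r \in remaining u v by rewrite rE inE eqxx.
have rn : r < n by move: rr; rewrite mem_filter mem_iota => /andP[].
pose r0 : list_graph W := Ordinal rn.
rewrite -rE => /allP conn.
have reach k (i : 'I_n) : (i : nat) \in iter k (reach_step u v) [:: r] ->
    connect (@del_edge (list_graph W) X) r0 i.
  elim: k i => [|k IH] i /=; first by
    rewrite inE => /eqP ir; rewrite (_ : i = r0) //; exact: val_inj.
  rewrite mem_filter => /andP[/orP[/IH //|/hasP[j jS aij]] irem].
  have jrem : j \in remaining u v.
    case: k {IH} jS => [|k] /=; first by rewrite inE => /eqP ->.
    by rewrite mem_filter => /andP[].
  have jn : j < n by move: jrem; rewrite mem_filter mem_iota => /andP[].
  apply: connect_trans (IH (Ordinal jn) jS) (connect1 _).
  rewrite /del_edge /= -!remE irem jrem /=.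
  by rewrite /list_rel adj_sym aij.
move=> x y; rewrite -!remE => /conn /reach xr /conn /reach yr.
by apply: connect_trans yr; rewrite csym.
Qed.

End Connectivity.

Section Isomorphism.
Variables (G H : sgraph) (f : G -> H) (g : H -> G).
Hypotheses (fK : cancel f g) (gK : cancel g f).
Hypothesis fE : forall x y, edge (f x) (f y) = edge x y.

Lemma isomorphic_kconnected k : kconnected k H -> kconnected k G.
Proof.
have GH : #|G| = #|H| by apply: bij_eq_card; exists g; [exact: fK|exact: gK].
case=> kH conn; split=> [|X Xk x y xX yX]; first by rewrite GH.
have fI : injective f := can_inj fK.
have fX z : (f z \in f @: X) = (z \in X) by rewrite mem_imset.
have := conn (f @: X) _ (f x) (f y); rewrite card_imset // !fX => /(_ Xk xX yX).
move=> /connectP[p]; elim: p x {xX} => [|z p IH] x /=.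
  by move=> _ /fI ->.
case/andP=> e hp hl; apply: (@connect_trans _ _ (g z)).
  by apply: connect1; move: e; rewrite /del_edge /= -(gK z) !fX fE gK.
by apply: IH; rewrite gK.
Qed.

End Isomorphism.

Fixpoint masks n : seq bitseq :=
  if n is m.+1 then map (cons true) (masks m) ++ map (cons false) (masks m)
  else [:: [::]].

Lemma mem_masks m : m \in masks (size m).
Proof.
elim: m => [|b m IH] //=; rewrite mem_cat; apply/orP.
by case: b; [left|right]; exact: map_f.
Qed.

(* Graphs are represented by the rows of their strictly upper triangular
   adjacency matrices. *)
Fixpoint graphs_of_degrees (fuel : nat) (s : seq nat) : seq (seq bitseq) :=
  if s is d :: r then
    if fuel is k.+1 then
      flatten [seq [seq m :: T | T <- graphs_of_degrees k
                     [seq db.1 - db.2 | db : nat * bool <- zip r m]]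
        | m <- masks (size r) &
          (count id m == d) && all (fun db : nat * bool => db.2 <= db.1) (zip r m)]
    else [::]
  else [:: [::]].

Section Rows.
Variable G : sgraph.

Fixpoint rows (e : seq G) : seq bitseq :=
  if e is x :: e' then map (edge x) e' :: rows e' else [::].

Lemma mem_graphs_of_degrees e :
  rows e \in graphs_of_degrees (size e) [seq count (edge x) e | x <- e].
Proof.
elim: e => [//|x e IH] /=; rewrite edge_irr add0n.
apply/flatten_mapP; exists (map (edge x) e).
  have := mem_masks (map (edge x) e); rewrite !size_map mem_filter => ->; rewrite andbT.
  rewrite count_map eqxx /= zip_map all_map; apply/allP => y ye /=.
  by rewrite edge_sym leq_addr.
apply: map_f; rewrite zip_map -map_comp.
rewrite (@eq_map _ _ _ (fun y => count (edge y) e)) // => y /=.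
by rewrite [edge x y]edge_sym addKn.
Qed.

Definition row_adj (T : seq bitseq) i j :=
  if i < j then nth false (nth [::] T i) (j - i.+1)
  else if j < i then nth false (nth [::] T j) (i - j.+1) else false.

Lemma row_adj_rows x0 e i j : i < size e -> j < size e ->
  row_adj (rows e) i j = edge (nth x0 e i) (nth x0 e j).
Proof.
have up : forall (e : seq G) i j, i < j -> j < size e ->
    nth false (nth [::] (rows e) i) (j - i.+1) = edge (nth x0 e i) (nth x0 e j).
  elim=> [//|x e' IH] [|i'] [|j'] //= ij je; last exact: IH.
  by rewrite subn1 /= (nth_map x0).
move=> ie je; rewrite /row_adj; case: ltngtP => [ij|ji|->].
- exact: up.
- by rewrite up // edge_sym.
- by rewrite edge_irr.
Qed.

End Rows.

Section Matching.
Variables (T : seq bitseq) (W : seq (seq nat)).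
Local Notation n := (size W).

Definition is_matching (p : seq nat) :=
  perm_eq p (iota 0 n) &&
  all (fun i => all (fun j =>
    row_adj T i j == adj W (nth 0 p i) (nth 0 p j)) (iota 0 n)) (iota 0 n).

Fixpoint find_matching (fuel : nat) (p : seq nat) : option (seq nat) :=
  if size p == n then Some p else
  if fuel is k.+1 then
    (fix try (cs : seq nat) : option (seq nat) :=
      if cs is c :: cs' then
        if (if c \in p then false else
            all (fun i => row_adj T i (size p) == adj W (nth 0 p i) c) (iota 0 (size p)))
        then if find_matching k (rcons p c) is Some q then Some q else try cs'
        else try cs'
      else None) (iota 0 n)
  else None.

Definition has_matching :=
  if find_matching n [::] is Some p then is_matching p else false.

End Matching.

Definition canonical_graphs : seq (seq nat * (seq (seq nat) * seq (nat * nat))) :=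
  zip forcibly_polyhedral_list [::
  ([:: [::]; [:: 0]; [:: 0; 1]; [:: 0; 1; 2]],
   [:: (0, 0); (3, 0); (0, 3); (1, 1)]);
  ([:: [::]; [:: 0]; [:: 0; 1]; [:: 0; 1; 2]; [:: 0; 1; 2]],
   [:: (0, 0); (1, 2); (4, 0); (0, 4); (2, 1)]);
  ([:: [::]; [:: 0]; [:: 0; 1]; [:: 0; 1; 2]; [:: 0; 1; 2]; [:: 0; 1; 3]],
   [:: (1, 1); (4, 0); (0, 4); (1, 2); (0, 0); (2, 1)]);
  ([:: [::]; [:: 0]; [:: 0; 1]; [:: 0; 1; 2]; [:: 0; 1; 2]; [:: 0; 1; 3]; [:: 0; 2; 3]],
   [:: (2, 4); (8, 0); (0, 0); (0, 8); (4, 1); (4, 3); (1, 3)]);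
  ([:: [::]; [:: 0]; [:: 0; 1]; [:: 0; 1; 2]; [:: 0; 1; 2]; [:: 0; 1; 3]; [:: 0;
      2; 3]; [:: 1; 2; 3]],
   [:: (4, 3); (0, 11); (11, 0); (5, 4); (0, 0); (2, 8); (7, 2); (5, 5)]);
  ([:: [::]; [:: 0]; [:: 0; 1]; [:: 0; 1]; [:: 0; 2; 3]; [:: 1; 2; 3; 4]],
   [:: (0, 0); (4, 0); (0, 4); (2, 1); (1, 1); (1, 2)]);
  ([:: [::]; [:: 0]; [:: 0; 1]; [:: 0; 1]; [:: 0; 2; 3]],
   [:: (0, 0); (4, 0); (0, 4); (2, 1); (1, 2)]);
  ([:: [::]; [:: 0]; [:: 0; 1]; [:: 0; 1]; [:: 0; 2]; [:: 0; 3; 4]],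
   [:: (0, 0); (4, 0); (0, 4); (2, 1); (1, 2); (1, 1)])
].

Definition canonical_ok (c : seq nat * (seq (seq nat) * seq (nat * nat))) :=
  let: (s, (W, pos)) := c in
  [&& graphical_by_layoff (size s) s, straight_line_ok W pos, three_connected W,
      size s == size W &
      all (fun T => has_matching T W) (graphs_of_degrees (size s) s)].

Lemma canonical_all_ok : all canonical_ok canonical_graphs.
Proof. by vm_compute. Qed.

Lemma matching_isomorphism (G : sgraph) (e : seq G) (W : seq (seq nat)) p :
  perm_eq e (enum G) -> size e = size W -> is_matching (rows e) W p ->
  exists (f : G -> list_graph W) (g : list_graph W -> G),
    [/\ cancel f g, cancel g f & forall x y, edge (f x) (f y) = edge x y].
Proof.
move=> he eW /andP[pp /allP hp].
have up : uniq p by rewrite (perm_uniq pp) iota_uniq.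
have sp : size p = size W by rewrite (perm_size pp) size_iota.
have ue : uniq e by rewrite (perm_uniq he) enum_uniq.
have ie x : index x e < size W by rewrite -eW index_mem (perm_mem he) mem_enum.
have np i : i < size W -> nth 0 p i < size W.
  by move=> iW; have := mem_nth 0 (s := p) (n := i); rewrite sp (perm_mem pp) mem_iota; apply.
have ip (j : 'I_(size W)) : index (j : nat) p < size W.
  rewrite -[X in _ < X]sp index_mem (perm_mem pp) mem_iota; exact: ltn_ord.
exists (fun x => Ordinal (np _ (ie x))).
exists (fun j => tnth (in_tuple e) (cast_ord (esym eW) (Ordinal (ip j)))).
have nthE (i : 'I_(size e)) x0 : tnth (in_tuple e) i = nth x0 e i.
  by rewrite (tnth_nth x0).
split.
- move=> x; rewrite (nthE _ x) /= index_uniq ?sp //.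
  by rewrite nth_index // (perm_mem he) mem_enum.
- move=> j; apply: val_inj => /=; set i := cast_ord _ _.
  rewrite (nthE _ (tnth (in_tuple e) i)) index_uniq ?ltn_ord // /i /=.
  by rewrite nth_index // (perm_mem pp) mem_iota ltn_ord.
- move=> x y; have := hp (index x e); rewrite mem_iota => /(_ (ie x)) /allP.
  move=> /(_ (index y e)); rewrite mem_iota => /(_ (ie y)) /eqP.
  rewrite (row_adj_rows x) ?eW // !nth_index ?(perm_mem he) ?mem_enum // => ->.
Qed.

Lemma canonical_polyhedral (R : realType) c G :
  canonical_ok c -> realisation c.1 G -> polyhedral R G.
Proof.
case: c => [s [W pos]] /= /and5P[_ okpos conn /eqP sW /allP match_all].
move=> /realisation_enum [e he sE].
have dE : s = [seq count (edge x) e | x <- e].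
  rewrite sE; apply: eq_map => x.
  by rewrite (permP he) /degree cardE size_filter enumT; apply: eq_count => y.
have eW : size e = size W by rewrite -sW sE size_map.
have := match_all (rows e); rewrite dE size_map => /(_ (mem_graphs_of_degrees e)).
rewrite /has_matching; case: find_matching => // p.
move=> /(matching_isomorphism he eW) [f [g [fK gK fE]]]; split.
  apply: planar_mono (straight_line_planar R okpos); first exact: can_inj fK.
  by move=> u v; rewrite fE.
exact: isomorphic_kconnected fK gK fE _ (three_connectedP conn).
Qed.

Lemma mem_forcibly_polyhedral (R : realType) t :
  t \in forcibly_polyhedral_list -> forcibly_polyhedral R t.
Proof.
move=> tL; have [c cc ct] : exists2 c, canonical_ok c & c.1 = t.
  have /(nthP [::])[i iL <-] := tL.
  exists (nth ([::], ([::], [::])) canonical_graphs i); last by rewrite nth_zip.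
  by apply: (allP canonical_all_ok); rewrite mem_nth.
split; last by move=> G; rewrite -ct; exact: canonical_polyhedral.
rewrite -ct; case: c cc {ct} => [s [W pos]] /and5P[gr _ _ _ _] /=.
exact: graphical_by_layoffP gr.
Qed.

Lemma octahedron_realisation : realisation (nseq 6 4) octahedron.
Proof.
have deg (x : octahedron) : degree x = 4.
  case: x => i b; transitivity #|finset.setX [set~ i] [set: bool]|.
    by apply: eq_card => -[j c]; rewrite !inE /= andbT eq_sym.
  by rewrite cardsX cardsC1 cardsT card_ord card_bool.
rewrite /realisation /degree_sequence.
rewrite (eq_map deg) (_ : map _ _ = nseq (size (enum octahedron)) 4); last first.
  by elim: (enum octahedron) => //= _ e ->.
by rewrite -cardE card_prod card_ord card_bool.
Qed.

Lemma degree_pyramid_apex n : @degree (pyramid n) None = n.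
Proof.
rewrite /degree -[RHS]card_ord -(fintype.card_image (f := @Some 'I_n)); last by move=> ? ? [].
apply: eq_card => -[i|]; rewrite !inE /=.
  by apply/esym/fintype.imageP; exists i.
by apply/esym/negP => /fintype.imageP[].
Qed.

Lemma degree_pyramid_base n (i : 'I_n) : ordS i != i -> ordS i != ord_pred i ->
  @degree (pyramid n) (Some i) = 3.
Proof.
move=> iS iSp.
have iP : ord_pred i != i by apply: contra iS => /eqP {1}<-; rewrite ord_predK.
rewrite /degree (cardD1 None) inE /= add1n; congr _.+1.
have -> : 2 = #|[set ordS i; ord_pred i]| by rewrite cards2 iSp.
rewrite -(fintype.card_image (f := @Some 'I_n)); last by move=> ? ? [].
apply: eq_card => -[j|]; rewrite !inE /=; last first.
  by apply/esym/negP => /fintype.imageP[].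
have jE : (j == i.+1 %% n :> nat) = (j == ordS i) by rewrite -val_eqE.
have iE : (i == j.+1 %% n :> nat) = (j == ord_pred i).
  by rewrite -[i == _ :> nat]/(i == ordS j) -(inj_eq (can_inj (@ord_predK n))) ?ordSK eq_sym.
rewrite jE iE; apply/andP/fintype.imageP => [[ij jSP]|[k kSP [->]]].
  by exists j; rewrite ?inE.
move: kSP; rewrite !inE => kSP; split=> //.
by case/orP: kSP => /eqP ->; rewrite eq_sym.
Qed.

Lemma pyramid_realisation n :
  (forall i : 'I_n, (ordS i != i) && (ordS i != ord_pred i)) ->
  realisation (n :: nseq n 3) (pyramid n).
Proof.
move=> ne; rewrite /realisation /degree_sequence.
have h : perm_eq (enum (pyramid n)) (None :: map Some (enum 'I_n)).
  apply: uniq_perm; first exact: enum_uniq.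
    rewrite /= map_inj_uniq ?enum_uniq ?andbT; last by move=> ? ? [].
    by apply/mapP => -[].
  move=> [i|]; rewrite mem_enum !inE //=.
  by apply/esym/mapP; exists i; rewrite ?mem_enum.
apply: perm_trans (perm_map _ h) _; rewrite /= degree_pyramid_apex perm_cons -map_comp.
rewrite (eq_map (g := fun _ => 3)); last first.
  by move=> i /=; case/andP: (ne i); exact: degree_pyramid_base.
have -> : [seq 3 | _ <- enum 'I_n] = nseq (size (enum 'I_n)) 3.
  by elim: (enum 'I_n) => //= _ e ->.
by rewrite -cardE card_ord.
Qed.

Theorem theorem1 (R : realType) :
  [/\ forall s : seq nat,
        forcibly_polyhedral R s <->
        exists2 t : seq nat, t \in forcibly_polyhedral_list & perm_eq s t,
      size forcibly_polyhedral_list = 8,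
      pairwise (fun s t : seq nat => ~~ perm_eq s t) forcibly_polyhedral_list
    & [/\ realisation (nseq 6 4) octahedron,
          realisation (4 :: nseq 4 3) (pyramid 4)
        & realisation (5 :: nseq 5 3) (pyramid 5)]].
Proof.
split=> [s|||].
- split; first exact: forcibly_polyhedral_mem.
  move=> [t /(mem_forcibly_polyhedral R) [gt pt] st]; split.
    by apply: graphical_perm gt; rewrite perm_sym.
  by move=> G sG; apply: pt; exact: realisation_perm sG.
- by [].
- by vm_compute.
- split; first exact: octahedron_realisation.
    by apply: pyramid_realisation => -[[|[|[|[|[]]]]]].
  by apply: pyramid_realisation => -[[|[|[|[|[|[]]]]]]].
Qed.
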